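(* Let $\mathcal{M}=(S,\mathit{Act},P,\mathsf{init})$ be a finite MDP in which every state is reachable from $\mathsf{init}$, let $\mathsf{Eff}\subseteq S\setminus\{\mathsf{init}\}$ be a nonempty set of terminal states, and let $\mathsf{Cause}\subseteq S\setminus\mathsf{Eff}$ be a nonempty set such that for every $c\in\mathsf{Cause}$ there is a scheduler $\mathfrak{S}$ with $\mathrm{Pr}^{\mathfrak{S}}_{\mathcal{M}}((\neg\mathsf{Cause})\,\mathrm{U}\,c)>0$. If $\mathsf{Cause}$ is not a GPR cause for $\mathsf{Eff}$ in $\mathcal{M}$, then there is a memoryless randomized scheduler for $\mathcal{M}^{\mathrm{wmin}}_{\mathsf{Cause}}$ refuting the GPR condition for $\mathsf{Cause}$ in $\mathcal{M}^{\mathrm{wmin}}_{\mathsf{Cause}}$, and there is a finite-memory scheduler for $\mathcal{M}$ with two memory cells refuting the GPR condition for $\mathsf{Cause}$ in $\mathcal{M}$.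
   Context: Schedulers are arbitrary (history-dependent, randomized) unless stated otherwise; a memoryless randomized scheduler chooses its action distribution based only on the current state; a finite-memory scheduler with two memory cells is one representable by a finite automaton with two states that updates its memory on the observed states and chooses distributions depending on the current state and memory cell. $\mathrm{Pr}^{\mathfrak{S}}_{\mathcal{M}}$ is the probability measure on maximal paths from $\mathsf{init}$; $\mathrm{Pr}^{\min}_{\mathcal{M},s}$ is the infimum over all schedulers starting in $s$. $\Diamond T$: eventually visiting $T$; $(\neg X)\,\mathrm{U}\,c$: visiting $c$ with no state of $X$ visited before. GPR cause: a set as in the hypothesis such that for every scheduler $\mathfrak{S}$ with $\mathrm{Pr}^{\mathfrak{S}}(\Diamond\mathsf{Cause})>0$: $\mathrm{Pr}^{\mathfrak{S}}(\Diamond\mathsf{Eff}\mid\Diamond\mathsf{Cause})>\mathrm{Pr}^{\mathfrak{S}}(\Diamond\mathsf{Eff})$. A scheduler $\mathfrak{S}$ refutes the GPR condition if $\mathrm{Pr}^{\mathfrak{S}}(\Diamond\mathsf{Cause})>0$ and $\mathrm{Pr}^{\mathfrak{S}}(\Diamond\mathsf{Eff}\mid\Diamond\mathsf{Cause})\le\mathrm{Pr}^{\mathfrak{S}}(\Diamond\mathsf{Eff})$. The MDP $\mathcal{M}^{\mathrm{wmin}}_{\mathsf{Cause}}$ arises from $\mathcal{M}$ by removing all enabled actions and transitions of the states in $\mathsf{Cause}$ and instead enabling, exactly in the states $s\in\mathsf{Cause}$, a fresh action $\gamma$ with $P(s,\gamma,\mathsf{eff})=\mathrm{Pr}^{\min}_{\mathcal{M},s}(\Diamond\mathsf{Eff})$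 and $P(s,\gamma,\mathsf{noeff})=1-\mathrm{Pr}^{\min}_{\mathcal{M},s}(\Diamond\mathsf{Eff})$, where $\mathsf{eff}\in\mathsf{Eff}$ is fixed and $\mathsf{noeff}$ is a (possibly fresh) terminal state not in $\mathsf{Eff}$. *)

(* Defs.v *)
From HB Require Import structures.
From mathcomp Require Import all_boot all_order all_algebra.
From mathcomp Require Import all_classical all_reals all_analysis.

Set Implicit Arguments.
Unset Strict Implicit.
Unset Printing Implicit Defensive.

Import Order.TTheory GRing.Theory Num.Theory.
Local Open Scope classical_set_scope.
Local Open Scope ring_scope.

Definition cylinder (T : choiceType) (p : seq (option T)) :
  set (nat -> option T) := [set w | mkseq w (size p) = p].

Definition cylinders (T : choiceType) : set (set (nat -> option T)) :=
  [set cylinder p | p in [set: seq (option T)]].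

Notation sequence_space T := (g_sigma_algebraType (@cylinders T)).

Lemma measurable_cylinder (T : choiceType) (p : seq (option T)) :
  measurable (cylinder p : set (sequence_space T)).
Proof. by apply: sub_sigma_algebra; exists p. Qed.

Lemma measurable_prefix (T : countType) (n : nat) (P : pred (seq (option T))) :
  measurable ([set w | P (mkseq w n)] : set (sequence_space T)).
Proof.
pose F k : set (sequence_space T) :=
  if unpickle k is Some p then if P p && (size p == n) then cylinder p else set0
  else set0.
have -> : [set w | P (mkseq w n)] = \bigcup_k F k.
  apply/seteqP; split => w /=.
    move=> Pw; exists (pickle (mkseq w n)) => //.
    by rewrite /F pickleK Pw size_mkseq eqxx /cylinder /= size_mkseq.
  move=> [k _]; rewrite /F; case: unpickle => // p; case: ifP => //.
  by move=> /andP[Pp /eqP sp]; rewrite /cylinder /= sp => ->.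
apply: bigcup_measurable => k _; rewrite /F; case: unpickle => [p|//].
by case: ifP => // _; exact: measurable_cylinder.
Qed.

(* Existence of a discrete stochastic process with prescribed one-step
   conditional probabilities q: the law of the sequence that a uniform point of
   [0, 1[ generates when [0, 1[ is subdivided according to q. *)
Section process.
Variables (R : realType) (T : finType) (q : seq (option T) -> option T -> R).
Hypothesis q_ge0 : forall h y, 0 <= q h y.
Hypothesis q_sum1 : forall h, \sum_y q h y = 1.
Local Notation X := (option T).

Let wt (h : seq X) : R := \prod_(i < size h) q (take i h) (nth None h i).
Let cum (h : seq X) (k : nat) : R := \sum_(z | (enum_rank z < k)%N) q h z.
Let lo (h : seq X) : R :=
  \sum_(i < size h) wt (take i h) * cum (take i h) (enum_rank (nth None h i)).
Let I (h : seq X) (x : R) : bool := (lo h <= x) && (x < lo h + wt h).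

Let wt_ge0 h : 0 <= wt h.
Proof. by apply: prodr_ge0. Qed.

Let wt_rcons h y : wt (rcons h y) = wt h * q h y.
Proof.
rewrite /wt size_rcons big_ord_recr /= nth_rcons ltnn eqxx -cats1 take_size_cat//.
congr (_ * _); apply: eq_bigr => i _.
by rewrite nth_cat ltn_ord takel_cat// ltnW.
Qed.

Let lo_rcons h y : lo (rcons h y) = lo h + wt h * cum h (enum_rank y).
Proof.
rewrite /lo size_rcons big_ord_recr /= nth_rcons ltnn eqxx -cats1 take_size_cat//.
congr (_ + _); apply: eq_bigr => i _.
by rewrite nth_cat ltn_ord takel_cat// ltnW.
Qed.

Let cum0 h : cum h 0 = 0.
Proof. by rewrite /cum big1. Qed.

Let cumS h y : cum h (enum_rank y).+1 = cum h (enum_rank y) + q h y.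
Proof.
rewrite /cum (bigD1 y) //= addrC; congr (_ + _); apply: eq_bigl => z.
rewrite ltnS [in RHS]ltn_neqAle andbC; congr (_ && _).
by rewrite -(inj_eq (@enum_rank_inj X)).
Qed.

Let cum_mono h j k : (j <= k)%N -> cum h j <= cum h k.
Proof.
move=> jk; rewrite /cum (big_mkcond (fun z => _ < j)%N).
rewrite (big_mkcond (fun z => _ < k)%N); apply: ler_sum => z _.
case: ifP => [zj|_]; last by case: ifP.
by rewrite (leq_trans zj jk).
Qed.

Let cumT h : cum h #|{: X}| = 1.
Proof. by rewrite /cum -[RHS](q_sum1 h); apply: eq_bigl => z; rewrite ltn_ord. Qed.

Let I_next h x : I h x -> exists y, I (rcons h y) x.
Proof.
move=> /andP[lx xl].
have exk : exists k, x < lo h + wt h * cum h k by exists #|{: X}|; rewrite cumT mulr1.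
case: (ex_minnP exk) => k xk mink.
case: k xk mink => [|k] xk mink; first by rewrite cum0 mulr0 addr0 ltNge lx in xk.
have kT : (k < #|{: X}|)%N by apply: mink; rewrite cumT mulr1.
exists (enum_val (Ordinal kT)).
rewrite /I lo_rcons wt_rcons enum_valK /= -addrA -mulrDr.
have := cumS h (enum_val (Ordinal kT)); rewrite enum_valK /= => <-.
by rewrite xk andbT leNgt; apply/negP => /mink; rewrite ltnn.
Qed.

Let I_rcons h y x : I (rcons h y) x =
  (lo h + wt h * cum h (enum_rank y) <= x) &&
  (x < lo h + wt h * cum h (enum_rank y).+1).
Proof. by rewrite /I lo_rcons wt_rcons -addrA -mulrDr cumS. Qed.

Let I_sub h y x : I (rcons h y) x -> I h x.
Proof.
rewrite I_rcons => /andP[lx xl]; apply/andP; split.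
  apply: le_trans lx; rewrite lerDl mulr_ge0// -(cum0 h); exact: cum_mono.
apply: lt_le_trans xl _; rewrite lerD2l -[leRHS]mulr1 -(cumT h).
by rewrite ler_wpM2l// cum_mono.
Qed.

Let I_disj_lt h y z x : (enum_rank y < enum_rank z)%N ->
  I (rcons h y) x -> I (rcons h z) x -> False.
Proof.
move=> yz; rewrite !I_rcons => /andP[_ xl] /andP[lx _].
have := le_lt_trans lx xl; rewrite ltNge => /negP; apply.
by rewrite lerD2l ler_wpM2l// cum_mono.
Qed.

Let I_inj h y z x : I (rcons h y) x -> I (rcons h z) x -> y = z.
Proof.
move=> Iy Iz; case: (ltngtP (enum_rank y) (enum_rank z)) => [yz|zy|/ord_inj/enum_rank_inj//].
- by case: (I_disj_lt yz Iy Iz).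
- by case: (I_disj_lt zy Iz Iy).
Qed.

Let next (h : seq X) (x : R) : X :=
  if [pick y | I (rcons h y) x] is Some y then y else None.

Let pre (x : R) : nat -> seq X :=
  fix pre n := if n is m.+1 then rcons (pre m) (next (pre m) x) else [::].

Let D (x : R) : nat -> X := fun n => next (pre x n) x.

Let mkseq_D x n : mkseq (D x) n = pre x n.
Proof. by elim: n => [|n IH] //; rewrite mkseqS IH. Qed.

Let I_nil x : I [::] x = (0 <= x) && (x < 1).
Proof. by rewrite /I /lo /wt !big_ord0 add0r. Qed.

Let I_pre x n : I [::] x -> I (pre x n) x.
Proof.
move=> I0; elim: n => [//|n IH] /=; rewrite /next; case: pickP => [//|H].
by have [y Iy] := I_next IH; have := H y; rewrite Iy.
Qed.

Let I_preP x h : I [::] x -> (pre x (size h) = h) <-> I h x.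
Proof.
move=> I0; split => [<-|]; first exact: I_pre.
elim/last_ind: h => [//|h y IH] Iy; rewrite size_rcons /= IH ?(I_sub Iy)//.
congr rcons; rewrite /next; case: pickP => [z Iz|/(_ y)]; last by rewrite Iy.
exact: (I_inj Iz Iy).
Qed.

Let I_notin x h : ~~ I [::] x -> ~~ I h x.
Proof. by move=> I0; elim/last_ind: h => [//|h y IH]; apply: contra IH; exact: I_sub. Qed.

Let pre_out x n : ~~ I [::] x -> pre x n = nseq n None.
Proof.
move=> I0; elim: n => [//|n IH] /=; rewrite IH.
have -> : next (nseq n None) x = None.
  by rewrite /next; case: pickP => [y Iy|//]; rewrite (negPf (I_notin _ I0)) in Iy.
by rewrite -cats1 -[_ :: nil]/(nseq 1 None) -nseqD addn1.
Qed.

Let Iset (h : seq X) : set R := [set x | I h x].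

Let IsetE h : Iset h = [set` `[lo h, lo h + wt h[%R].
Proof. by apply/seteqP; split => x /=; rewrite in_itv. Qed.

Let preim_cyl h : D @^-1` (cylinder h) =
  Iset h `|` (if h == nseq (size h) None then ~` Iset [::] else set0).
Proof.
apply/seteqP; split => x; rewrite /preimage /cylinder /= mkseq_D.
  case: (boolP (I [::] x)) => I0; first by move=> /(I_preP _ I0) ?; left.
  by rewrite pre_out// => <-; right; rewrite size_nseq eqxx; apply/negP.
move=> [Ih|].
  have I0 : I [::] x by apply: contraT => /(I_notin h); rewrite Ih.
  exact/I_preP.
by case: eqP => // hE /negP /= I0; rewrite pre_out.
Qed.

Let mIset h : measurable (Iset h : set (measurableTypeR R)).
Proof. by rewrite IsetE; exact: measurable_itv. Qed.

Let mD : @measurable_fun _ _ (measurableTypeR R) (sequence_space T) setT D.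
Proof.
apply: (@measurability _ _ (measurableTypeR R) (sequence_space T) setT D (@cylinders T)) => //.
move=> _ [_ [h _ <-] <-]; rewrite setTI preim_cyl; apply: measurableU => //.
by case: ifP => _ //; apply: measurableC.
Qed.

Let leb : {measure set (measurableTypeR R) -> \bar R} :=
  mrestr (@lebesgue_measure R) (mIset [::]).
Let mu : set (sequence_space T) -> \bar R :=
  @pushforward _ _ (measurableTypeR R) (sequence_space T) R leb D.

Let mu0 : mu set0 = 0%E.
Proof. by rewrite /mu /pushforward preimage_set0 measure0. Qed.

Let mu_ge0 B : (0 <= mu B)%E.
Proof. exact: measure_ge0. Qed.

Let mu_sigma_additive : semi_sigma_additive mu.
Proof.
move=> F mF tF mUF; rewrite /mu /pushforward preimage_bigcup.
apply: measure_semi_sigma_additive.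
- by move=> n; rewrite -[X in measurable X]setTI; exact: mD.
- apply/trivIsetP => /= i j _ _ ij; rewrite -preimage_setI.
  by move/trivIsetP : tF => /(_ _ _ _ _ ij) ->//; rewrite preimage_set0.
- by rewrite -preimage_bigcup -[X in measurable X]setTI; exact: mD.
Qed.

Let mu_cyl h : mu (cylinder h) = (wt h)%:E.
Proof.
rewrite /mu /= /pushforward /leb /= /mrestr preim_cyl.
have -> : (Iset h `|` (if h == nseq (size h) None then ~` Iset [::] else set0))
    `&` Iset [::] = Iset h.
  apply/seteqP; split => x /=.
    by move=> [[//|]]; case: ifP.
  move=> Ih; split; first by left.
  by apply: contraT => /(I_notin h); rewrite /Iset /= in Ih; rewrite Ih.
rewrite IsetE lebesgue_measure_itv /= lte_fin ltrDl.
case: ltP => [_|w0]; first by rewrite -EFinD addrAC subrr add0r.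
by congr EFin; apply/eqP; rewrite eq_le wt_ge0.
Qed.

Let mu_setT : mu setT = 1%E.
Proof.
have -> : setT = cylinder ([::] : seq X) by apply/seteqP; split.
by rewrite mu_cyl /wt big_ord0.
Qed.

Lemma process_exists : exists mu : probability (sequence_space T) R,
  forall p, mu (cylinder p) = (\prod_(i < size p) q (take i p) (nth None p i))%:E.
Proof.
pose m := isMeasure.Build _ _ _ mu mu0 mu_ge0 mu_sigma_additive.
pose nu : {measure set (sequence_space T) -> \bar R} := HB.pack mu m.
pose b := Measure_isProbability.Build _ _ _ nu mu_setT.
pose P : probability (sequence_space T) R := HB.pack (nu : set _ -> _) nu b.
by exists P => p; exact: mu_cyl.
Qed.

End process.

Section mdp.
Variables (R : realType) (S A : finType).

Record mdp := MDP {
  init : S;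
  trans : S -> A -> S -> R;
  trans_ge0 : forall s a t, 0 <= trans s a t;
  trans_sum : forall s a, \sum_t trans s a t = 0 \/ \sum_t trans s a t = 1
}.

Variable M : mdp.

Definition enabled (s : S) (a : A) : bool := \sum_t trans M s a t == 1.

Definition terminal (s : S) : bool := [forall a, ~~ enabled s a].

Definition reachable (s : S) : bool :=
  connect [rel u t | [exists a, 0 < trans M u a t]] (init M) s.

(* A finite path s a1 s1 ... an sn is given by its first state s and the list
   h = [:: (a1, s1); ...; (an, sn)]. *)
Definition last_state (s : S) (h : seq (A * S)) : S := last s (map snd h).

(* In a terminal state the second condition leaves only the null distribution. *)
Record scheduler := Scheduler {
  choice :> S -> seq (A * S) -> A -> R;
  choice_ge0 : forall s h a, 0 <= choice s h a;
  choice_enabled : forall s h a, ~~ enabled (last_state s h) a -> choice s h a = 0;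
  choice_sum : forall s h, ~~ terminal (last_state s h) -> \sum_a choice s h a = 1
}.

(* Maximal paths from s are encoded as sequences of optional (action, state)
   steps: a finite maximal path is continued by None for ever. *)
Definition run := nat -> option (A * S).

Definition history (w : run) (n : nat) : seq (A * S) := pmap id (mkseq w n).

Definition maximal_path (s : S) : set (sequence_space (A * S)%type) :=
  [set w | forall n, if w n is Some (a, t)
                     then 0 < trans M (last_state s (history w n)) a t
                     else terminal (last_state s (history w n))].

Section path_measure.
Variables (sigma : scheduler) (s : S).

Definition step_prob (h : seq (A * S)) (x : option (A * S)) : R :=
  if x is Some (a, t) then sigma s h a * trans M (last_state s h) a t
  else (terminal (last_state s h))%:R.

Definition prefix_prob (p : seq (option (A * S))) : R :=
  \prod_(i < size p) step_prob (pmap id (take i p)) (nth None p i).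

Lemma step_prob_ge0 h x : 0 <= step_prob h x.
Proof.
case: x => [[a t]|] /=; last exact: ler0n.
by rewrite mulr_ge0 ?choice_ge0 ?trans_ge0.
Qed.

Lemma step_prob_sum h : \sum_x step_prob h x = 1.
Proof.
set u := last_state s h.
have -> : \sum_x step_prob h x = (terminal u)%:R + \sum_a sigma s h a.
  rewrite (bigD1 None) //=; congr (_ + _).
  rewrite (reindex_omap Some id) /=; last by case.
  rewrite (eq_bigl predT) => [|y]; last by rewrite eqxx.
  transitivity (\sum_p (fun a t => sigma s h a * trans M u a t) p.1 p.2).
    by apply: eq_bigr => -[a t].
  rewrite -(pair_bigA _ (fun a t => sigma s h a * trans M u a t)) /=.
  apply: eq_bigr => a _; rewrite -mulr_sumr.
  have [/eqP ->|na] := boolP (enabled u a); first by rewrite mulr1.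
  by rewrite choice_enabled// mul0r.
have [tu|ntu] := boolP (terminal u); last by rewrite choice_sum// add0r.
rewrite big1 ?addr0// => a _; apply: choice_enabled.
by move/forallP : tu.
Qed.

Lemma path_measure_exists : exists mu : probability (sequence_space (A * S)%type) R,
  forall p, mu (cylinder p) = (prefix_prob p)%:E.
Proof.
exact: (@process_exists R _ (fun p => step_prob (pmap id p))
  (fun p => step_prob_ge0 (pmap id p)) (fun p => step_prob_sum (pmap id p))).
Qed.

(* The cylinder probabilities determine this measure, as the cylinders together
   with the empty set form a pi-system generating the sigma-algebra. *)
Definition path_measure : probability (sequence_space (A * S)%type) R :=
  sval (cid path_measure_exists).

Lemma path_measure_cylinder p : path_measure (cylinder p) = (prefix_prob p)%:E.
Proof. exact: svalP (cid path_measure_exists) p. Qed.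

Lemma path_measure_maximal : path_measure (maximal_path s) = 1%E.
Proof.
pose ok (h : seq (A * S)) (x : option (A * S)) : bool :=
  if x is Some (a, t) then 0 < trans M (last_state s h) a t
  else terminal (last_state s h).
pose F n : set (sequence_space (A * S)%type) :=
  if unpickle n is Some (p, x) then
    if ok (pmap id p) x then set0 else cylinder (rcons p x)
  else set0.
have mF n : measurable (F n).
  rewrite /F; case: unpickle => [[p x]|//].
  by case: ifP => // _; exact: measurable_cylinder.
have F0 n : path_measure (F n) = 0%E.
  rewrite /F; case: unpickle => [[p x]|]; last exact: measure0.
  case: ifP => [_|]; first exact: measure0.
  move=> nok; rewrite path_measure_cylinder /prefix_prob size_rcons.
  rewrite big_ord_recr /= nth_rcons ltnn eqxx -cats1 take_size_cat//.
  suff -> : step_prob (pmap id p) x = 0 by rewrite mulr0.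
  case: x nok => [[a t]|] /= => [|->//].
  move/negbT; rewrite lt_neqAle trans_ge0 andbT negbK => /eqP <-.
  by rewrite mulr0.
have maxE : maximal_path s = ~` \bigcup_n F n.
  apply/seteqP; split => w.
    move=> mw [n _]; rewrite /F; case: unpickle => [[p x]|//].
    case: ifP => //= nok; rewrite /cylinder /= size_rcons mkseqS.
    move=> /rcons_inj[wp wx]; have := mw (size p); rewrite /history wp wx.
    by rewrite -/(is_true (ok _ _)); case: x nok {wx} => [[a t]|] /= ->.
  move=> nF n; suff : ok (history w n) (w n).
    by rewrite /ok; case: (w n) => [[a t]|].
  apply: contraT => nok; exfalso; apply: nF.
  exists (pickle (mkseq w n, w n)) => //; rewrite /F pickleK ifN//.
  by rewrite /cylinder /= size_rcons size_mkseq mkseqS.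
have mU : measurable (\bigcup_n F n) by exact: bigcup_measurable.
rewrite maxE probability_setC//.
suff -> : path_measure (\bigcup_n F n) = 0%E by rewrite sube0.
apply/negligibleP => //; apply: negligible_bigcup => n.
by exists (F n); split => //; exact: F0.
Qed.

Definition Pr (E : set (sequence_space (A * S)%type)) : R := fine (path_measure E).

Definition cond_Pr (E F : set (sequence_space (A * S)%type)) : R :=
  Pr (E `&` F) / Pr F.

End path_measure.

Definition state_at (s : S) (w : run) (n : nat) : option S :=
  if n is m.+1 then omap snd (w m) else Some s.

Definition diamond (s : S) (T : {set S}) : set (sequence_space (A * S)%type) :=
  [set w | exists n t, state_at s w n = Some t /\ t \in T].

Lemma measurable_diamond s T : measurable (diamond s T).
Proof.
pose P n (p : seq (option (A * S))) : bool :=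
  if (if n is m.+1 then omap snd (nth None p m) else Some s) is Some t
  then t \in T else false.
have -> : diamond s T =
    \bigcup_n ([set w | P n (mkseq w n)] : set (sequence_space (A * S)%type)).
  apply/seteqP; split => w /=.
    move=> [n [t [st tT]]]; exists n => //=; rewrite /P.
    by case: n st => [[->]//|n] /= st; rewrite nth_mkseq// st.
  move=> [n _] /=; rewrite /P => H; exists n.
  case: n H => [|n] /=; first by exists s.
  by rewrite nth_mkseq//; case: (w n) => [[a t]|] //= tT; exists t.
by apply: bigcup_measurable => n _; exact: measurable_prefix.
Qed.

(* (not X) U c *)
Definition not_until (s : S) (X : {set S}) (c : S) :
    set (sequence_space (A * S)%type) :=
  [set w | exists n, state_at s w n = Some c /\
     forall k t, (k < n)%N -> state_at s w k = Some t -> t \notin X].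

Definition Pr_min (s : S) (T : {set S}) : R :=
  inf [set Pr sigma s (diamond s T) | sigma in [set: scheduler]].

Definition memoryless (sigma : scheduler) : Prop :=
  exists d : S -> A -> R, forall s h a, sigma s h a = d (last_state s h) a.

(* The memory automaton has read all states of the finite path, including the
   current one, when the distribution is chosen. *)
Definition finite_memory (k : nat) (sigma : scheduler) : Prop :=
  exists (m0 : 'I_k) (upd : 'I_k -> S -> 'I_k) (d : 'I_k -> S -> A -> R),
    forall s h a,
      sigma s h a = d (foldl upd m0 (s :: map snd h)) (last_state s h) a.

Section GPR.
Variables (Eff Cause : {set S}).

Local Notation Diamond := (diamond (init M)).

Definition GPR_condition (sigma : scheduler) : Prop :=
  Pr sigma (init M) (Diamond Eff) <
  cond_Pr sigma (init M) (Diamond Eff) (Diamond Cause).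

Definition each_cause_reached_first : Prop :=
  forall c, c \in Cause ->
    exists sigma, 0 < Pr sigma (init M) (not_until (init M) Cause c).

Definition GPR_cause : Prop :=
  [/\ Cause \subset ~: Eff, Cause != finset.set0, each_cause_reached_first &
      forall sigma, 0 < Pr sigma (init M) (Diamond Cause) -> GPR_condition sigma].

Definition refutes_GPR (sigma : scheduler) : Prop :=
  0 < Pr sigma (init M) (Diamond Cause) /\
  cond_Pr sigma (init M) (Diamond Eff) (Diamond Cause) <=
  Pr sigma (init M) (Diamond Eff).

End GPR.

Lemma Pr_itv (sigma : scheduler) (s : S) (E : set (sequence_space (A * S)%type)) :
  measurable E -> 0 <= Pr sigma s E <= 1.
Proof.
move=> mE; rewrite /Pr fine_ge0//= -lee_fin fineK ?fin_num_measure//.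
exact: probability_le1.
Qed.

Lemma Pr_min_itv (s : S) (T : {set S}) : 0 <= Pr_min s T <= 1.
Proof.
have PE sigma := Pr_itv sigma s (measurable_diamond s T).
rewrite /Pr_min; set E := [set _ | _ in _].
have [->|/set0P[x Ex]] := eqVneq E set0; first by rewrite inf0 lexx ler01.
have E0 : lbound E 0 by move=> _ [sigma _ <-]; case/andP: (PE sigma).
rewrite lb_le_inf//=; last by exists x.
apply: (@le_trans _ _ x); first by apply: ge_inf => //; exists 0.
by case: Ex => sigma _ <-; case/andP: (PE sigma).
Qed.

End mdp.

Section wmin.
Variables (R : realType) (S A : finType) (M : mdp R S A).
Variables (Eff Cause : {set S}) (eff : S) (noeff : option S).

(* The state space S together with noeff, where noeff = None stands for a fresh
   state and noeff = Some t for the state t of M. *)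
Definition wmin_state : finType := {x : option S | isSome x || (x == noeff)}.

Definition wmin_embed (s : S) : wmin_state := exist _ (Some s) isT.

Fact wmin_noeff_subproof : isSome noeff || (noeff == noeff).
Proof. by rewrite eqxx orbT. Qed.

Definition wmin_noeff : wmin_state := exist _ noeff wmin_noeff_subproof.

(* None is the fresh action gamma. *)
Definition wmin_trans (u : wmin_state) (b : option A) (v : wmin_state) : R :=
  match val u, b with
  | Some s, Some a =>
      if s \in Cause then 0 else if val v is Some t then trans M s a t else 0
  | Some s, None =>
      if s \in Cause then
        Pr_min M s Eff * (v == wmin_embed eff)%:R +
        (1 - Pr_min M s Eff) * (v == wmin_noeff)%:R
      else 0
  | None, _ => 0
  end.

Lemma wmin_trans_ge0 u b v : 0 <= wmin_trans u b v.
Proof.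
rewrite /wmin_trans; case: (val u) b => [s|] [a|] //; case: ifP => // _.
  by case: (val v) => // t; exact: trans_ge0.
have /andP[p0 p1] := Pr_min_itv M s Eff.
by rewrite addr_ge0// mulr_ge0// ?subr_ge0// ler0n.
Qed.

Lemma wmin_trans_sum u b :
  \sum_v wmin_trans u b v = 0 \/ \sum_v wmin_trans u b v = 1.
Proof.
rewrite /wmin_trans; case: u => [[s|] pu] /=; last by left; rewrite big1.
case: b => [a|]; case: (s \in Cause); try by left; rewrite big1.
  have -> : \sum_(v : wmin_state) (if val v is Some t then trans M s a t else 0) =
      \sum_t trans M s a t.
    rewrite (bigID (fun v : wmin_state => isSome (val v))) /= addrC big1.
      rewrite add0r (reindex_omap wmin_embed (fun v : wmin_state => val v))/=.
        by apply: eq_bigl => t; rewrite eqxx.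
      by move=> [[t|] //= p] _; congr Some; apply: val_inj.
    by move=> [[t|] //= p].
  exact: trans_sum.
have sum1 (w : wmin_state) : \sum_(v : wmin_state) (v == w)%:R = 1 :> R.
  by rewrite (bigD1 w)//= eqxx big1 ?addr0// => v /negPf ->.
by right; rewrite big_split /= -!mulr_sumr !sum1 !mulr1 addrC subrK.
Qed.

Definition wmin : mdp R wmin_state (option A) :=
  MDP (wmin_embed (init M)) wmin_trans_ge0 wmin_trans_sum.

End wmin.

(* Main.v *)
Require Import Defs.
From mathcomp Require Import all_boot all_order all_algebra.
From mathcomp Require Import all_classical all_reals all_analysis.
From mathcomp Require Import ring lra.
Import Order.TTheory GRing.Theory Num.Theory.
Import numFieldNormedType.Exports.
Local Open Scope classical_set_scope.
Local Open Scope ring_scope.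
Set Implicit Arguments.
Unset Strict Implicit.
Unset Printing Implicit Defensive.

(* Let T = Cause u Eff, let p t be the probability that t is the first state of
   T to be visited, and let w c be the minimal probability of reaching Eff from
   c.  As nothing happens after Eff, a scheduler refutes the GPR condition as
   soon as it acts optimally after Cause and
     sum_Cause w p <= (sum_Cause p) * (sum_Cause w p + sum_Eff p),   0 < sum_Cause p,
   and every refuting scheduler has a vector p with this property; call such a
   vector refuting.  It remains to replace an arbitrary scheduler by a
   memoryless one whose vector p is refuting.
   Expected numbers of visits may be infinite, but those of the first n steps
   form finite flows whose boundary values converge.  Finitely generated cones
   are closed, so in the limit there is a finite flow with the same vector p that
   stops only inside a set X in which a scheduler can stay for ever.  Choose an
   absorbing set D, as large as possible, such that a refuting flow exists in
   which D is never left, and then a flow for D that stops with the least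
   probability.  If it still stopped, say exactly in the states of B, then
   either all runs that enter B could stop there, against the choice of D, or,
   the quadratic condition being concave along increasing vectors, one could
   extrapolate away from that flow, against the minimality.  A flow that never
   stops is normalised to a memoryless scheduler with the same vector p. *)

(** * Finitely generated cones are closed *)

Lemma cvg_sumr (R : realType) (I : finType) (P : pred I) (T : Type)
    (F : set_system T) (FF : Filter F) (f : I -> T -> R) (l : I -> R) :
  (forall i, P i -> f i x @[x --> F] --> l i) ->
  \sum_(i | P i) f i x @[x --> F] --> \sum_(i | P i) l i.
Proof. by apply: cvg_big; exact: add_continuous. Qed.

Lemma eq_cvgn (R : realType) (u v : nat -> R) (l : R) :
  v =1 u -> u n @[n --> \oo] --> l -> v n @[n --> \oo] --> l.
Proof. by move=> /funext ->. Qed.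

Lemma cvgnB (R : realType) (u v : nat -> R) (a b : R) :
  u n @[n --> \oo] --> a -> v n @[n --> \oo] --> b ->
  u n - v n @[n --> \oo] --> a - b.
Proof. exact: cvgB. Qed.

Lemma cvgn_unique (R : realType) (u v : nat -> R) (a b : R) : u =1 v ->
  u n @[n --> \oo] --> a -> v n @[n --> \oo] --> b -> a = b.
Proof. move=> /funext ->; exact: cvg_unique. Qed.

Lemma ptws_cvgn (R : realType) (I : finType) (b : nat -> {ptws I -> R}) (l : {ptws I -> R}) :
  (forall i, b n i @[n --> \oo] --> l i) -> b @ \oo --> l.
Proof.
move=> bl; apply/cvg_sup => i U [V] [[W] oW <-] Wl WU.
have /bl Wb : nbhs (l i) W by exact: open_nbhs_nbhs.
by apply: (@filterS _ \oo _ _ _ _ Wb) => n Wn; exact: WU.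
Qed.

Section cone.
Variables (R : realType) (J I : finType) (A : J -> I -> R).

Definition comb (y : J -> R) (i : I) : R := \sum_j y j * A j i.

Definition cone : set {ptws I -> R} :=
  [set b | exists2 y, (forall j, 0 <= y j) & forall i, comb y i = b i].

Let supp (y : J -> R) : {set J} := [set j | y j != 0]%SET.

(** Carathéodory's argument, by induction on the size of the support: as long as the columns in the
    support of [y] satisfy a linear relation [v], subtracting a suitable multiple of [v] keeps [y]
    nonnegative and kills a coordinate. *)
Lemma cone_reduce (y : J -> R) : (forall j, 0 <= y j) ->
  exists y', [/\ forall j, 0 <= y' j, forall i, comb y' i = comb y i &
    forall v, (forall j, y' j = 0 -> v j = 0) -> (forall i, comb v i = 0) ->
      forall j, v j = 0].
Proof.
have [n] := ubnP #|supp y|; elim: n y => // n IH y /ltnSE sy y0.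
have [uniq_y|] := pselect (forall v, (forall j, y j = 0 -> v j = 0) ->
  (forall i, comb v i = 0) -> forall j, v j = 0); first by exists y.
move=> /existsNP[v /not_implyP[vsupp /not_implyP[v0 /existsNP[j0 /eqP vj0]]]].
wlog vpos : v vsupp v0 vj0 / 0 < v j0.
  move=> H; have [vp|] := ltP 0 (v j0); first exact: H vp.
  rewrite le_eqVlt (negPf vj0) /= => vn.
  apply: (H (fun j => - v j)).
  - by move=> j /vsupp ->; rewrite oppr0.
  - move=> i; rewrite -[RHS]oppr0 -(v0 i) /comb -sumrN.
    by apply: eq_bigr => j _; rewrite mulNr.
  - by rewrite oppr_eq0.
  - by rewrite oppr_gt0.
(* The smallest ratio [y j / v j] with [0 < v j] is the largest multiple of [v] that may be
   subtracted; the coordinate [j1] attaining it becomes zero. *)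
case: (@arg_minP _ _ _ j0 (fun j => 0 < v j) (fun j => y j / v j) vpos) => j1 vj1 min1.
set th := y j1 / v j1 in min1.
have th0 : 0 <= th by rewrite divr_ge0// ltW.
pose y1 j := y j - th * v j.
have y10 j : 0 <= y1 j.
  rewrite subr_ge0; have [vj|vj] := ltP 0 (v j).
    by rewrite -ler_pdivlMr//; exact: min1.
  by rewrite (le_trans _ (y0 j))// mulr_ge0_le0.
have y1z j : y j = 0 -> y1 j = 0 by move=> yj; rewrite /y1 yj (vsupp _ yj) mulr0 subr0.
have cy1 i : comb y1 i = comb y i.
  rewrite -[RHS]subr0 -(mulr0 th) -(v0 i) /comb mulr_sumr -sumrB.
  by apply: eq_bigr => j _; rewrite /y1 mulrBl mulrA.
have [|y' [y'0 y'c y'u]] := IH y1 _ y10; last first.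
  by exists y'; split => // i; rewrite y'c cy1.
apply: leq_trans sy; apply: proper_card; apply/properP; split.
  by apply/fintype.subsetP => j; rewrite !inE; apply: contraNN => /eqP/y1z/eqP.
exists j1; rewrite !inE; first by apply: contraTN vj1 => /eqP/vsupp ->; rewrite ltxx.
by rewrite negbK /y1 /th divfK ?subrr// (gt_eqF vj1).
Qed.

(** A pseudo-inverse solves for coefficients on the columns in [K], so they depend linearly, hence
    continuously, on the target vector; their signs are not controlled. *)
Lemma cone_solver (K : {set J}) : exists L : I -> J -> R,
  (forall i j, j \notin K -> L i j = 0) /\
  (forall y, (forall j, j \notin K -> y j = 0) ->
     forall i, comb (fun j => \sum_k comb y k * L k j) i = comb y i).
Proof.
pose B : 'M[R]_(#|J|, #|I|) :=
  \matrix_(j, i) if enum_val j \in K then A (enum_val j) (enum_val i) else 0.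
exists (fun i j => if j \in K then pinvmx B (enum_rank i) (enum_rank j) else 0).
split=> [i j /negPf ->//|y yK i].
pose yr : 'rV[R]_#|J| := \row_j y (enum_val j).
have combE (v : J -> R) k : (forall j, j \notin K -> v j = 0) ->
    comb v k = ((\row_j v (enum_val j)) *m B) 0 (enum_rank k).
  move=> vK; rewrite /comb mxE (reindex_onto enum_val enum_rank) /=; last first.
    by move=> j _; rewrite enum_rankK.
  rewrite (eq_bigl predT) => [|j]; last by rewrite enum_valK eqxx.
  apply: eq_bigr => j _; rewrite !mxE enum_rankK.
  by case: ifPn => // /vK ->; rewrite !mul0r.
rewrite combE; last first.
  by move=> j /negPf jK; rewrite big1// => k _; rewrite jK mulr0.
rewrite (combE y)//.
have E := mulmxKpV (submxMl yr B).
rewrite -[in RHS]E; congr ((_ : 'M[R]_(_, _)) _ _).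
apply/rowP => k; rewrite !mxE; apply: eq_bigr => j _; rewrite !mxE.
case: ifPn => jK; last by rewrite !mulr0.
congr (_ * _).
rewrite [RHS](reindex _ (onW_bij _ (@enum_rank_bij I))) /=.
by apply: eq_bigr => k' _; rewrite combE// enum_valK.
Qed.

(** The cone is a finite union over sets [K] of columns: the part for [K] consists of the vectors
    that the linear solver for [K] reproduces with nonnegative coefficients, which are closed
    conditions. *)
Lemma closed_cone : closed cone.
Proof.
pose L K := sval (cid (cone_solver K)).
have LK (K : {set J}) i j : j \notin K -> L K i j = 0 by apply: (svalP (cid (cone_solver K))).1.
have LE (K : {set J}) y (yK : forall j, j \notin K -> y j = 0) i :
    comb (fun j => \sum_k comb y k * L K k j) i = comb y i.
  exact: (svalP (cid (cone_solver K))).2.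
pose P K : set {ptws I -> R} :=
  (\bigcap_j [set b : {ptws I -> R} | 0 <= \sum_k b k * L K k j]) `&`
  (\bigcap_i [set b : {ptws I -> R} | comb (fun j => \sum_k b k * L K k j) i - b i = 0]).
have -> : cone = \bigcup_(K in [set: {set J}]) P K.
  apply/seteqP; split => b.
    move=> [y0 y00 y0b]; have [y [yge0 yc yu]] := cone_reduce y00.
    pose K := [set j | y j != 0]%SET.
    have yK j : j \notin K -> y j = 0 by rewrite inE negbK => /eqP.
    have bE i : comb y i = b i by rewrite yc.
    (* The columns in [K] are independent, so the solver returns the nonnegative coefficients [y]
       themselves. *)
    have ylin j : \sum_k b k * L K k j = y j.
      apply/eqP; rewrite -subr_eq0; apply/eqP.
      apply: (yu (fun j => \sum_k b k * L K k j - y j)) => [j' yj'|i].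
        rewrite yj' subr0 big1// => k _; rewrite LK ?mulr0// inE yj' eqxx.
        by [].
      rewrite -[RHS](subrr (comb y i)) -[X in _ = X - _](LE K)//.
      rewrite /comb -sumrB; apply: eq_bigr => j' _; rewrite mulrBl; congr (_ * _ - _).
      by apply: eq_bigr => k _; rewrite -[in RHS]/(comb y k) bE.
    exists K => //; split=> [j _|i _] /=; first by rewrite ylin.
    rewrite -bE; apply/eqP; rewrite subr_eq0; apply/eqP.
    by apply: eq_bigr => j _; rewrite ylin.
  move=> [K _ [b0 bE]]; exists (fun j => \sum_k b k * L K k j) => [j|i].
    exact: b0.
  by apply/eqP; rewrite -subr_eq0; apply/eqP; exact: (bE i Logic.I).
have cproj i : continuous (fun b : {ptws I -> R} => b i).
  exact: (@proj_continuous I (fun=> R : topologicalType) i).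
have clin (c : I -> R) : continuous (fun b : {ptws I -> R} => \sum_k b k * c k).
  apply: (@continuous_big R _ +%R 0 xpredT (@add_continuous R)) => k _ b.
  apply: (@cvgM R _ (nbhs b) _ (fun b => b k) (cst (c k))); first exact: cproj.
  exact: cvg_cst.
apply: closed_bigcup => [|K _]; first exact: finite_finset.
apply: closedI; apply: closed_bigI => i _.
  apply: (@preimage_closed _ _ (fun b : {ptws I -> R} => \sum_k b k * L K k i)
    [set x | 0 <= x]); last exact: closed_ge.
  by move=> b _; exact: clin.
apply: (@preimage_closed _ _ (fun b : {ptws I -> R} =>
    comb (fun j => \sum_k b k * L K k j) i - b i) [set x | x = 0]); last exact: closed_eq.
move=> b _; apply: (@cvgB R R _ (nbhs b)); last exact: cproj.
apply: (@continuous_big R _ +%R 0 xpredT (@add_continuous R)) => j _ {}b.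
apply: (@cvgM R _ (nbhs b) _ (fun b => \sum_k b k * L K k j) (cst (A j i))).
  exact: clin.
exact: cvg_cst.
Qed.

End cone.

(** * Flows with stopping *)

Section flow.
Variables (R : realType) (S A : finType) (M : mdp R S A) (T : {set S}).
Implicit Types (y : S -> A -> R) (z p : S -> R) (X D : {set S}).

Definition source (s : S) : R := (s == init M)%:R.
Definition outflow y s : R := \sum_a y s a.
Definition inflow y t : R := \sum_s \sum_a y s a * trans M s a t.
Definition balance y z s : R := outflow y s + z s - inflow y s.
(** In [T] and [D], where runs end, this expected number of visits is a probability. *)
Definition hits y t : R := source t + inflow y t.

(** The sets in which some scheduler can stay for ever without visiting [T]; resting in a terminal
    state counts as staying. *)
Definition absorbing D : Prop := forall s, s \in D ->
  s \notin T /\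
  (terminal M s \/ exists2 a, enabled M s a & forall t, 0 < trans M s a t -> t \in D).

(* [y s a] is the expected number of times that [a] is taken in [s], and [z s]
   the probability of stopping in [s]; runs that enter [T] or [D] end there. *)
Record preflow X D y z : Prop := Preflow {
  pf_ge0 : forall s a, 0 <= y s a;
  pf_stop_ge0 : forall s, 0 <= z s;
  pf_supp : forall s a, [|| s \in T, s \in D | ~~ enabled M s a] -> y s a = 0;
  pf_stop_supp : forall s, ~~ [&& s \notin T, s \notin D & s \in X] -> z s = 0 }.

Definition flow X D y z : Prop := preflow X D y z /\
  forall s, s \notin T -> s \notin D -> balance y z s = source s.

Lemma source_ge0 s : 0 <= source s.
Proof. exact: ler0n. Qed.

Lemma sum_source : \sum_s source s = 1.
Proof. by rewrite (bigD1 (init M))//= big1 ?addr0 /source ?eqxx// => s /negPf ->. Qed.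

Lemma inflow_ge0 y t : (forall s a, 0 <= y s a) -> 0 <= inflow y t.
Proof. by move=> y0; do 2!apply: sumr_ge0 => ? _; rewrite mulr_ge0// trans_ge0. Qed.

Lemma hits_ge0 y t : (forall s a, 0 <= y s a) -> 0 <= hits y t.
Proof. by move=> y0; rewrite addr_ge0 ?source_ge0 ?inflow_ge0. Qed.

Lemma le_inflow y y' t : (forall s a, y s a <= y' s a) -> inflow y t <= inflow y' t.
Proof. by move=> yy; do 2!apply: ler_sum => ? _; rewrite ler_wpM2r ?trans_ge0. Qed.

Lemma outflow_terminal y s : (forall a, ~~ enabled M s a -> y s a = 0) ->
  terminal M s -> outflow y s = 0.
Proof. by move=> ys /forallP ts; apply: big1 => a _; exact: ys. Qed.

Lemma inflow_lin (c c' : R) y y' t :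
  inflow (fun s a => c * y s a + c' * y' s a) t = c * inflow y t + c' * inflow y' t.
Proof.
rewrite /inflow !mulr_sumr -big_split; apply: eq_bigr => s _ /=.
rewrite !mulr_sumr -big_split; apply: eq_bigr => a _ /=; ring.
Qed.

Lemma inflow_sum n (yn : nat -> S -> A -> R) t :
  inflow (fun s a => \sum_(i < n) yn i s a) t = \sum_(i < n) inflow (yn i) t.
Proof.
rewrite /inflow [RHS]exchange_big; apply: eq_bigr => s _ /=.
by rewrite [RHS]exchange_big; apply: eq_bigr => a _ /=; rewrite mulr_suml.
Qed.

Lemma inflowB y y' t :
  inflow y t - inflow y' t = inflow (fun s a => y s a - y' s a) t.
Proof.
rewrite /inflow -sumrB; apply: eq_bigr => s _.
by rewrite -sumrB; apply: eq_bigr => a _; rewrite mulrBl.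
Qed.

Lemma outflow_lin (c c' : R) y y' s :
  outflow (fun s a => c * y s a + c' * y' s a) s = c * outflow y s + c' * outflow y' s.
Proof. by rewrite /outflow !mulr_sumr -big_split. Qed.

Lemma balance_lin (c c' : R) y y' z z' s :
  balance (fun s a => c * y s a + c' * y' s a) (fun s => c * z s + c' * z' s) s =
  c * balance y z s + c' * balance y' z' s.
Proof. rewrite /balance inflow_lin outflow_lin; ring. Qed.

Lemma sum_inflow y : (forall s a, ~~ enabled M s a -> y s a = 0) ->
  \sum_t inflow y t = \sum_s outflow y s.
Proof.
move=> ys; rewrite /inflow exchange_big /=; apply: eq_bigr => s _.
rewrite exchange_big /=; apply: eq_bigr => a _; rewrite -mulr_sumr.
by have [/eqP ->|/ys ->] := boolP (enabled M s a); rewrite ?mulr1 ?mul0r.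
Qed.

Lemma pf_enabled X D y z : preflow X D y z ->
  forall s a, ~~ enabled M s a -> y s a = 0.
Proof. by move=> pf s a sa; apply: (pf_supp pf); rewrite sa !orbT. Qed.

Lemma sum_balance X D y z : preflow X D y z -> \sum_s balance y z s = \sum_s z s.
Proof.
move=> pf; rewrite /balance sumrB big_split /= (sum_inflow (pf_enabled pf)); ring.
Qed.

Lemma balance_out X D y z s : preflow X D y z ->
  (s \in T) || (s \in D) -> balance y z s = - inflow y s.
Proof.
move=> pf sTD; rewrite /balance /outflow big1 => [|a _]; last first.
  by apply: (pf_supp pf); rewrite orbA sTD.
rewrite (pf_stop_supp pf) ?addr0 ?add0r//.
by case/orP: sTD => ->; rewrite ?andbF.
Qed.

Lemma hits_balance X D y z t : preflow X D y z ->
  t \in T -> hits y t = source t - balance y z t.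
Proof. by move=> pf tT; rewrite (balance_out pf) ?tT// opprK. Qed.

(** Conservation of mass: in the sum of all balances the transitions cancel, so the unit of mass
    that starts in [init M] either stops or enters [T] or [D]. *)
Lemma flow_mass X D y z : flow X D y z ->
  \sum_s z s + \sum_(s | (s \in T) || (s \in D)) hits y s = 1.
Proof.
move=> [pf fl]; rewrite -(sum_balance pf) -sum_source.
rewrite [X in X + _](bigID (fun s => (s \in T) || (s \in D))) /=.
rewrite [RHS](bigID (fun s => (s \in T) || (s \in D))) /= addrAC -big_split /=.
congr (_ + _); last first.
  by apply: eq_bigr => s; rewrite negb_or => /andP[sT sD]; exact: fl.
apply: eq_bigr => s sTD; rewrite (balance_out pf sTD) /hits; ring.
Qed.

(** The generators of the cone of balances of preflows. Those that a preflow excludes are zero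
    columns, so that the index type does not depend on [X] and [D]. *)
Definition flow_column X D (j : (S * A) + S) (i : S) : R :=
  match j with
  | inl (s, a) => if [|| s \in T, s \in D | ~~ enabled M s a] then 0
                  else (i == s)%:R - trans M s a i
  | inr s => if [&& s \notin T, s \notin D & s \in X] then (i == s)%:R else 0
  end.

Lemma comb_flow_column X D (v : (S * A) + S -> R) i :
  comb (flow_column X D) v i =
  balance (fun s a => if [|| s \in T, s \in D | ~~ enabled M s a] then 0 else v (inl (s, a)))
    (fun s => if [&& s \notin T, s \notin D & s \in X] then v (inr s) else 0) i.
Proof.
rewrite /comb big_sumType /= /balance addrAC; congr (_ + _); last first.
  rewrite (bigD1 i)//= eqxx big1 ?addr0 => [|s /negPf si]; last first.
    by rewrite eq_sym si; case: ifP; rewrite mulr0.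
  by case: ifP; rewrite ?mulr1 ?mulr0.
have -> : outflow (fun s a => if [|| s \in T, s \in D | ~~ enabled M s a] then 0
    else v (inl (s, a))) i = \sum_s \sum_a
    (if [|| s \in T, s \in D | ~~ enabled M s a] then 0 else v (inl (s, a))) * (i == s)%:R.
  rewrite (bigD1 i)//= [X in _ + X]big1 ?addr0 => [|s /negPf si].
    by apply: eq_bigr => a _; rewrite eqxx mulr1.
  by rewrite big1// => a _; rewrite eq_sym si mulr0.
rewrite /inflow -sumrB.
transitivity (\sum_s \sum_a v (inl (s, a)) * flow_column X D (inl (s, a)) i).
  rewrite (pair_bigA _ (fun s a => v (inl (s, a)) * flow_column X D (inl (s, a)) i)) /=.
  by apply: eq_bigr => -[s a].
apply: eq_bigr => s _; rewrite -sumrB; apply: eq_bigr => a _ /=.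
by case: ifP => _; rewrite ?mulr0 ?mul0r ?subr0 ?mulrBr.
Qed.

Lemma flow_coneP X D (b : S -> R) : cone (flow_column X D) b <->
  exists y z, preflow X D y z /\ forall i, balance y z i = b i.
Proof.
split; last first.
  move=> [y [z [pf yb]]].
  exists (fun j => match j with inl (s, a) => y s a | inr s => z s end).
    by move=> [[s a]|s]; [exact: (pf_ge0 pf)|exact: (pf_stop_ge0 pf)].
  move=> i; rewrite comb_flow_column -yb /balance; congr (_ + _ - _).
  - by apply: eq_bigr => a _; case: ifPn => // /(pf_supp pf) ->.
  - by case: ifPn => // /(pf_stop_supp pf) ->.
  - apply: eq_bigr => s _; apply: eq_bigr => a _.
    by case: ifPn => // /(pf_supp pf) ->.
move=> [v v0 vb].
eexists; eexists; split; last by move=> i; rewrite -vb comb_flow_column.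
by split=> [s a|s|s a|s] /=; case: ifP.
Qed.

(** * From the masses of a scheduler at each time to a finite flow *)

Section limit.
Variables (x : nat -> S -> R) (y : nat -> S -> A -> R) (p : S -> R).
Hypothesis y_ge0 : forall n s a, 0 <= y n s a.
Hypothesis y_supp : forall n s a, (s \in T) || ~~ enabled M s a -> y n s a = 0.
Hypothesis x0 : forall s, x 0 s = source s.
Hypothesis xS : forall n s, x n.+1 s = inflow (y n) s.
Hypothesis y_out : forall n s, s \notin T -> ~~ terminal M s -> outflow (y n) s = x n s.
Hypothesis x_sum : forall t, t \in T -> (\sum_(i < n) x i t) @[n --> \oo] --> p t.

Lemma x_ge0 n s : 0 <= x n s.
Proof. by case: n => [|n]; rewrite ?x0 ?xS ?source_ge0 ?inflow_ge0. Qed.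

Let vanishes s := x n s @[n --> \oo] --> (0 : R).

Let vanishes_T t : t \in T -> vanishes t.
Proof.
move=> tT; have /(_ t tT) xt := x_sum.
have xt1 : (\sum_(i < n.+1) x i t) @[n --> \oo] --> p t.
  by move: xt; rewrite -(cvg_shiftS (fun n => \sum_(i < n) x i t)).
rewrite /vanishes -(subrr (p t)).
apply: eq_cvgn (cvgB xt1 xt) => n /=.
by rewrite big_ord_recr /= addrC addKr.
Qed.

(** Where the limit flow may stop: mass persists in these states, or gets stuck there because they
    are terminal. *)
Let Xset : {set S} := [set s | (s \notin T) && (terminal M s || ~~ `[< vanishes s >])]%SET.

(** If every enabled action of a nonterminal [s] could leave [Xset], each would lead with positive
    probability to a state whose mass vanishes; then [y n s a] vanishes for every [a], and with it
    the mass of [s]. *)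
Lemma absorbing_limit : absorbing Xset.
Proof.
move=> s; rewrite inE => /andP[sT]; have [ts _|ts /= /asboolPn nv] := boolP (terminal M s).
  by split; [|left].
split => //; right; apply: contrapT => nex; apply: nv.
have van_y a : y n s a @[n --> \oo] --> (0 : R).
  have [sa|sa] := boolP (enabled M s a); last first.
    by apply: eq_cvgn (cvg_cst 0) => n; rewrite y_supp ?sa ?orbT.
  have [t [tpos tX]] : exists t, 0 < trans M s a t /\ t \notin Xset.
    apply: contrapT => nt; apply: nex; exists a => // t tpos.
    by apply: contrapT => /negP tX; apply: nt; exists t.
  have vt : vanishes t.
    have [/vanishes_T//|tT] := boolP (t \in T).
    by move: tX; rewrite inE tT /= negb_or negbK => /andP[_ /asboolP].
  have vt1 : x n.+1 t / trans M s a t @[n --> \oo] --> (0 : R).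
    rewrite -(mul0r (trans M s a t)^-1); apply: cvgM; last exact: cvg_cst.
    by move: vt; rewrite /vanishes -(cvg_shiftS (fun n => x n t)).
  apply: (@squeeze_cvgr _ _ _ _ (fun=> 0)); last 1 first.
  - exact: vt1.
  - apply: nearW => n; rewrite y_ge0 /= ler_pdivlMr// xS /inflow.
    rewrite (bigD1 s)//= (bigD1 a)//= -addrA lerDl addr_ge0//.
      by apply: sumr_ge0 => a' _; rewrite mulr_ge0 ?trans_ge0.
    by do 2!apply: sumr_ge0 => ? _; rewrite mulr_ge0 ?trans_ge0.
  - exact: cvg_cst.
rewrite /vanishes; have -> : (0 : R) = \sum_(a : A) 0 by rewrite big1.
apply: eq_cvgn (@cvg_sumr _ _ xpredT _ \oo _ (fun a n => y n s a) _ (fun a _ => van_y a)).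
by move=> n; rewrite -y_out.
Qed.

(** The sums over the first [n] steps form preflows that satisfy the flow equations up to a
    vanishing defect. They may diverge, but their balances converge, and closedness of the cone
    provides a flow with the limit balance. *)
Lemma flow_limit : exists2 X, absorbing X &
  exists y z, flow X finset.set0 y z /\ forall t, t \in T -> hits y t = p t.
Proof.
exists Xset; first exact: absorbing_limit.
pose Y n s a := \sum_(i < n) y i s a.
(* Mass that is in [Xset] at time [n] stops there, and so does mass that was in a terminal state
   earlier; in other states of [Xset] the summands are zero. *)
pose Z n s := if s \in Xset then \sum_(i < n) (x i s - outflow (y i) s) + x n s else 0.
have XT s : s \in Xset -> s \notin T by rewrite inE => /andP[].
have pf n : preflow Xset finset.set0 (Y n) (Z n).
  split=> [s a|s|s a|s].
  - by apply: sumr_ge0.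
  - rewrite /Z; case: ifP => // sX; rewrite addr_ge0 ?x_ge0//; apply: sumr_ge0 => i _.
    have [ts|ts] := boolP (terminal M s); last by rewrite y_out ?XT// subrr.
    by rewrite outflow_terminal ?subr0 ?x_ge0// => a sa; rewrite y_supp ?sa ?orbT.
  - rewrite inE /= => sa; apply: big1 => i _; exact: y_supp.
  - by rewrite finset.in_set0 /= /Z; case: ifP => // sX; rewrite XT.
have sumS n s : \sum_(i < n) x i.+1 s = \sum_(i < n.+1) x i s - source s.
  by rewrite big_ord_recl /= x0 addrC addKr.
have inY n s : inflow (Y n) s = \sum_(i < n) x i.+1 s.
  by rewrite inflow_sum; apply: eq_bigr => i _; rewrite xS.
have outY n s : outflow (Y n) s = \sum_(i < n) outflow (y i) s.
  by rewrite /outflow exchange_big.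
pose b : S -> R := fun s => if s \in T then source s - p s else source s.
have /flow_coneP[y' [z' [pf' bal']]] : cone (flow_column Xset finset.set0) b.
  apply: (@closed_cvg _ {ptws S -> R} \oo _ (fun n => balance (Y n) (Z n)) _
    (@closed_cone R _ S (flow_column Xset finset.set0))).
    by apply: nearW => n; apply/flow_coneP; exists (Y n), (Z n).
  apply: ptws_cvgn => s; rewrite /b; case: ifPn => sT.
    have := x_sum sT; rewrite -(cvg_shiftS (fun n => \sum_(i < n) x i s)) => xs.
    apply: eq_cvgn (cvgnB (cvg_cst (source s)) xs) => n /=.
    rewrite (balance_out (pf n)) ?sT// inY sumS; ring.
  have [sX|sX] := boolP (s \in Xset).
    apply: eq_cvgn (cvg_cst (source s)) => n /=.
    rewrite /balance inY outY /Z sX sumrB sumS big_ord_recr /=; ring.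
  (* Outside [Xset] and [T] the defect is exactly the mass at time [n]. *)
  have vs : vanishes s.
    by move: sX; rewrite inE sT /= negb_or negbK => /andP[_ /asboolP].
  rewrite -[X in _ --> X](subr0 (source s)).
  apply: eq_cvgn (cvgnB (cvg_cst (source s)) vs) => n /=.
  rewrite /balance inY outY /Z (negPf sX) sumS big_ord_recr /=.
  have -> : \sum_(i < n) outflow (y i) s = \sum_(i < n) x i s; last by ring.
  apply: eq_bigr => i _; apply: y_out => //.
  by move: sX; rewrite inE sT /= negb_or => /andP[].
exists y', z'; split; first by split => // s sT _; rewrite bal' /b (negPf sT).
by move=> t tT; rewrite (hits_balance pf')// bal' /b tT; ring.
Qed.

End limit.

(** * Memoryless policies from flows that never stop *)

Definition policy (d : S -> A -> R) : Prop :=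
  [/\ forall s a, 0 <= d s a,
      forall s a, ~~ enabled M s a -> d s a = 0 &
      forall s, ~~ terminal M s -> \sum_a d s a = 1].

Lemma policy_sum_le1 d s : policy d -> \sum_a d s a <= 1.
Proof.
move=> [_ dis dsum]; have [/forallP ts|ts] := boolP (terminal M s).
  by rewrite big1 ?ler01// => a _; exact: dis.
by rewrite dsum.
Qed.

(* The probability of being in [s] after [n] steps without having visited [T] before. *)
Fixpoint mass (d : S -> A -> R) (n : nat) : S -> R :=
  if n is m.+1 then inflow (fun s a => (s \notin T)%:R * mass d m s * d s a)
  else source.

Definition point_choice (Q : S -> pred A) (s : S) (a : A) : R :=
  ([pick b | Q s b] == Some a)%:R.

Lemma point_choice_sum (Q : S -> pred A) s : (exists a, Q s a) -> \sum_a point_choice Q s a = 1.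
Proof.
move=> [a Qa]; rewrite /point_choice; case: pickP => [b _|/(_ a)]; last by rewrite Qa.
rewrite (bigD1 b)//= eqxx big1 ?addr0// => c /negPf cb.
by rewrite (inj_eq Some_inj) eq_sym cb.
Qed.

Lemma point_choice_neq0 (Q : S -> pred A) s a : point_choice Q s a != 0 -> Q s a.
Proof.
rewrite /point_choice; case: pickP => [b Qb|_]; last by rewrite eqxx.
by case: (eqVneq b a) => [<-//|/negPf ba]; rewrite (inj_eq Some_inj) ba eqxx.
Qed.

Lemma nonterminal_enabled s : ~~ terminal M s -> exists a, enabled M s a.
Proof. by rewrite negb_forall => /existsP[a]; rewrite negbK; exists a. Qed.

Lemma policy_exists : exists d, policy d.
Proof.
exists (point_choice (enabled M)); split=> [s a|s a|s].
- exact: ler0n.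
- by move=> /negP sa; apply/eqP/negPn/negP => /point_choice_neq0.
- by move=> /nonterminal_enabled; exact: point_choice_sum.
Qed.

Section flow_policy.
Variables (X D : {set S}) (y : S -> A -> R).
Hypotheses (D_abs : absorbing D) (y_flow : flow X D y (fun=> 0)).

Let in_D s a := [forall t, (0 < trans M s a t) ==> (t \in D)] && enabled M s a.
Let live s := (s \notin T) && (s \notin D).

(** Inside [D], which the flow does not describe, an action that never leaves [D] is picked; where
    the outflow is zero, any enabled action will do. *)
Let d s a : R :=
  if s \in D then point_choice in_D s a
  else if outflow y s != 0 then y s a / outflow y s
  else point_choice (enabled M) s a.

Let y_ge0 := pf_ge0 y_flow.1.
Let out_ge0 s : 0 <= outflow y s. Proof. exact: sumr_ge0. Qed.

Let d_policy : policy d.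
Proof.
split=> [s a|s a sa|s ts]; rewrite /d.
- case: ifP => _; first exact: ler0n.
  by case: ifP => _; [rewrite divr_ge0|exact: ler0n].
- case: ifP => _.
    by apply/eqP; apply: contraNT sa => /point_choice_neq0 /andP[].
  case: ifP => _; first by rewrite (pf_supp y_flow.1) ?mul0r// sa !orbT.
  by apply/eqP; apply: contraNT sa => /point_choice_neq0.
- have [sD|/negPf sD] := boolP (s \in D); rewrite ?sD.
    apply: point_choice_sum; have [_ [ts'|[a sa aD]]] := D_abs sD; first by rewrite ts' in ts.
    by exists a; rewrite /in_D sa andbT; apply/forallP => t; apply/implyP; exact: aD.
  case: (eqVneq (outflow y s) 0) => [nz|nz]; last by rewrite -mulr_suml divff.
  exact/point_choice_sum/nonterminal_enabled.
Qed.

Let d_D s a t : s \in D -> t \notin D -> d s a * trans M s a t = 0.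
Proof.
move=> sD tD; rewrite /d sD; have [->|/point_choice_neq0/andP[/forallP /(_ t) H _]] :=
  eqVneq (point_choice in_D s a) 0; first by rewrite mul0r.
move: (trans_ge0 M s a t); rewrite le_eqVlt => /orP[/eqP <-|Pt]; first by rewrite mulr0.
by rewrite Pt (negPf tD) in H.
Qed.

Let yE s a : live s -> y s a = outflow y s * d s a.
Proof.
move=> /andP[sT sD]; rewrite /d (negPf sD); case: ifPn => [nz|].
  by rewrite mulrCA divff ?mulr1.
rewrite negbK => /eqP nz; rewrite nz mul0r; apply/eqP; move/eqP: nz.
by rewrite psumr_eq0// => /allP /(_ a); rewrite mem_index_enum => /(_ isT).
Qed.

(* What remains of the expected number of visits to [s] after [n] steps. *)
Let rest n s : R := if live s then outflow y s - \sum_(i < n) mass d i s else 0.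
Let rest_in n := inflow (fun s a => rest n s * d s a).

Let rest_inE n t : t \notin D ->
  hits y t - \sum_(i < n.+1) mass d i t = rest_in n t.
Proof.
move=> tD; rewrite big_ord_recl /= /hits opprD addrACA subrr add0r.
rewrite -(inflow_sum n (fun i s a => (s \notin T)%:R * mass d i s * d s a)) inflowB /rest_in.
apply: eq_bigr => s _; apply: eq_bigr => a _.
rewrite -mulr_suml /rest.
have [sl|] := boolP (live s).
  have [sT _] := andP sl.
  rewrite yE// -mulrBl; congr ((_ - _) * _ * _).
  by apply: eq_bigr => i _; rewrite sT mul1r.
rewrite negb_and !negbK mul0r mul0r => /orP[sT|sD].
  rewrite (pf_supp y_flow.1) ?sT// big1 ?mul0r ?subr0 ?mul0r// => i _.
  by rewrite mul0r.
by rewrite (pf_supp y_flow.1) ?sD ?orbT// sub0r mulNr -mulrA d_D// mulr0 oppr0.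
Qed.

Let restS n s : live s -> rest n.+1 s = rest_in n s.
Proof.
move=> sl; have [sT sD] := andP sl; rewrite -rest_inE// /rest sl; congr (_ - _).
have := y_flow.2 s sT sD; rewrite /balance addr0 => /eqP.
by rewrite subr_eq => /eqP.
Qed.

Let rest_ge0 n s : 0 <= rest n s.
Proof.
elim: n s => [|n IH] s.
  by rewrite /rest; case: ifP => // _; rewrite big_ord0 subr0.
have [sl|/negPf sl] := boolP (live s); last by rewrite /rest sl.
rewrite restS//; apply: inflow_ge0 => u a; rewrite mulr_ge0//.
by case: d_policy.
Qed.

Let rest_in_ge0 n s : 0 <= rest_in n s.
Proof. by apply: inflow_ge0 => u a; rewrite mulr_ge0//; case: d_policy. Qed.

(** What enters [t] leaves the live states for good, so it is bounded by the decrease of the total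
    remainder. *)
Let rest_in_le n t : t \in T ->
  rest_in n t <= \sum_s rest n s - \sum_s rest n.+1 s.
Proof.
move=> tT; rewrite lerBrDr.
have le1 : \sum_s rest_in n s <= \sum_s rest n s.
  rewrite sum_inflow => [|s a sa]; last first.
    by case: d_policy => _ -> //; rewrite mulr0.
  apply: ler_sum => s _; rewrite /outflow -mulr_sumr ler_piMr//.
  exact: policy_sum_le1.
apply: le_trans le1; rewrite [leRHS](bigD1 t)//= lerD2l.
rewrite (bigD1 t)//= {1}/rest /live tT add0r; apply: ler_sum => s _.
have [sl|/negPf sl] := boolP (live s); first by rewrite restS.
by rewrite {1}/rest sl.
Qed.

(** The flow dominates the expected visits of the policy, so the total remainder is nonnegative and
    converges. Its limit need not be zero, since [y] may contain circulations, but the part that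
    enters [T] is bounded by the differences of a convergent sequence. *)
Lemma flow_policy : exists2 e, policy e &
  forall t, t \in T -> (\sum_(i < n) mass e i t) @[n --> \oo] --> hits y t.
Proof.
exists d => // t tT.
have tD : t \notin D by apply/negP => /D_abs[]; rewrite tT.
pose r n := \sum_s rest n s.
have /cvg_ex[/= l rl] : cvgn r.
  apply: nonincreasing_is_cvgn; last by exists 0 => _ [n _ <-]; exact: sumr_ge0.
  apply/nonincreasing_seqP => n; rewrite -subr_ge0.
  exact: le_trans (rest_in_le n tT).
have rl1 : r n.+1 @[n --> \oo] --> l by rewrite (cvg_shiftS r).
have in0 : rest_in n t @[n --> \oo] --> (0 : R).
  apply: (@squeeze_cvgr _ _ _ _ (fun=> 0) (fun n => r n - r n.+1)).
  - by apply: nearW => n; rewrite rest_in_ge0 /= rest_in_le.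
  - exact: cvg_cst.
  - by rewrite -(subrr l); exact: cvgnB.
have hyt : (fun _ : nat => hits y t) n @[n --> \oo] --> hits y t by exact: cvg_cst.
have := cvgnB hyt in0; rewrite subr0 => lim_rest.
suff : (\sum_(i < n.+1) mass d i t) @[n --> \oo] --> hits y t.
  by rewrite (cvg_shiftS (fun n => \sum_(i < n) mass d i t)).
by apply: eq_cvgn lim_rest => n; rewrite -rest_inE//; ring.
Qed.

End flow_policy.

End flow.

(** * Refuting vectors and flows of least stopping probability *)

Section refuting_flow.
Variables (R : realType) (S A : finType) (M : mdp R S A) (T : {set S}).
Variables (f g h : S -> R).
Hypotheses (f_ge0 : forall s, 0 <= f s) (f_le_g : forall s, f s <= g s)
  (h_ge0 : forall s, 0 <= h s).
Implicit Types (y : S -> A -> R) (z p : S -> R) (X D : {set S}).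

Definition lin (k : S -> R) p : R := \sum_(t in T) k t * p t.

(** Used with [g] the indicator of [Cause], [f] its product with the minimal probability of reaching
    [Eff], and [h] the sum of [f] and the indicator of [Eff]. If a scheduler minimises the
    probability of [Eff] after [Cause], then [lin f], [lin g] and [lin h] give the probabilities of
    reaching both sets, [Cause], and [Eff]. *)
Definition refuting p : Prop := lin f p <= lin g p * lin h p /\ 0 < lin g p.

Lemma eq_lin k p q : {in T, p =1 q} -> lin k p = lin k q.
Proof. by move=> pq; apply: eq_bigr => t tT; rewrite pq. Qed.

Lemma eq_refuting p q : {in T, p =1 q} -> refuting p -> refuting q.
Proof. by move=> pq; rewrite /refuting !(eq_lin _ pq). Qed.

Lemma lin_lin k (a b : R) p q :
  lin k (fun t => a * p t + b * q t) = a * lin k p + b * lin k q.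
Proof.
rewrite /lin !mulr_sumr -big_split; apply: eq_bigr => t _ /=; ring.
Qed.

Lemma le_lin k p q : (forall s, 0 <= k s) -> {in T, forall t, p t <= q t} ->
  lin k p <= lin k q.
Proof. by move=> k0 pq; apply: ler_sum => t tT; rewrite ler_wpM2l// pq. Qed.

Lemma lin_ge0 k p : (forall s, 0 <= k s) -> {in T, forall t, 0 <= p t} ->
  0 <= lin k p.
Proof. by move=> k0 pq; apply: sumr_ge0 => t tT; rewrite mulr_ge0// pq. Qed.

Let g_ge0 s : 0 <= g s. Proof. exact: le_trans (f_le_g s). Qed.

(* On a half line along which all components of [p] grow, the quadratic function
   [lin f p - lin g p * lin h p] is concave. *)
Lemma refuting_extrapolate (c : R) p q : 0 <= c ->
  {in T, forall t, 0 <= q t} -> {in T, forall t, q t <= p t} ->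
  refuting p -> ~ refuting q ->
  refuting (fun t => (1 + c) * p t + (- c) * q t) /\
  lin g p <= lin g (fun t => (1 + c) * p t + (- c) * q t).
Proof.
move=> c0 q0 qp [Qp gp] nq.
have gqp := le_lin g_ge0 qp; have hqp := le_lin h_ge0 qp.
have Qq : lin g q * lin h q <= lin f q.
  have [gq|gq] := ltP 0 (lin g q).
    by rewrite leNgt; apply/negP => /ltW ?; apply: nq.
  have -> : lin g q = 0 by apply/eqP; rewrite eq_le gq lin_ge0.
  by rewrite mul0r lin_ge0.
rewrite /refuting !lin_lin.
have gle : lin g p <= (1 + c) * lin g p + - c * lin g q by nra.
split => //; split; last exact: lt_le_trans gle.
(* With [Q r = lin f r - lin g r * lin h r], the value of [Q] at the new point is
   [(1 + c) * Q p - c * Q q] minus this product, and [Q p <= 0 <= Q q]. *)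
have : 0 <= c * (1 + c) * ((lin g p - lin g q) * (lin h p - lin h q)).
  by rewrite !mulr_ge0 ?subr_ge0// addr_ge0.
have : c * (lin g q * lin h q) <= c * lin f q by rewrite ler_wpM2l.
have : (1 + c) * lin f p <= (1 + c) * (lin g p * lin h p).
  by rewrite ler_wpM2l// addr_ge0.
nra.
Qed.

Definition refuting_flow X D y z := flow M T X D y z /\ refuting (hits M y).

Lemma flow_le1 X D y z s : flow M T X D y z -> (s \in T) || (s \in D) ->
  0 <= hits M y s <= 1.
Proof.
move=> fl sTD; have y0 := pf_ge0 fl.1; rewrite hits_ge0//=.
rewrite -(flow_mass fl) [X in _ + X](bigD1 s)//= addrCA lerDl addr_ge0//.
  by apply: sumr_ge0 => u _; exact: pf_stop_ge0 fl.1 u.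
by apply: sumr_ge0 => u _; exact: hits_ge0.
Qed.

Lemma closed_preimage_continuous (F : {ptws S -> R} -> R) (B : set R) :
  continuous F -> closed B -> closed (F @^-1` B).
Proof. by move=> cF; apply: preimage_closed => b _; exact: cF. Qed.

Lemma proj_ptws_continuous s : continuous (fun b : {ptws S -> R} => b s).
Proof. exact: (@proj_continuous S (fun=> R : topologicalType) s). Qed.

Lemma lin_continuous k :
  continuous (fun b : {ptws S -> R} => lin k (fun t => source M t - b t)).
Proof.
apply: (@continuous_big R _ +%R 0 (mem T) (@add_continuous R)) => t _ b.
apply: (@cvgM R _ (nbhs b) _ (cst (k t)) (fun b => source M t - b t)); first exact: cvg_cst.
apply: (@cvgB R R _ (nbhs b) _ (cst (source M t)) (fun b => b t)); first exact: cvg_cst.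
exact: proj_ptws_continuous.
Qed.

(** Compactness. Circulations may make the flows unbounded, so the minimum is taken over their
    balances: these form a closed set, lie between -1 and 1, and sum to the stopping probability. *)
Lemma min_stop_flow X D y0 z0 : refuting_flow X D y0 z0 ->
  exists y z, refuting_flow X D y z /\
    forall y' z', refuting_flow X D y' z' ->
      lin g (hits M y) <= lin g (hits M y') -> \sum_s z s <= \sum_s z' s.
Proof.
(* The lower bound [c0] replaces the strict inequality in [refuting], which is not a closed
   condition. *)
move=> [fl0 ref0]; pose c0 := lin g (hits M y0).
(* On [T] the balance is minus the inflow, so it determines [hits]. *)
pose p (b : {ptws S -> R}) : S -> R := fun t => source M t - b t.
pose W : set {ptws S -> R} := cone (flow_column M T X D) `&`
  (\bigcap_(s in [set s | s \notin T /\ s \notin D]) (fun b => b s) @^-1` [set source M s]) `&`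
  ((fun b => lin g (p b) * lin h (p b) - lin f (p b)) @^-1` [set r | 0 <= r]) `&`
  ((fun b => lin g (p b)) @^-1` [set r | c0 <= r]).
have WP y z : preflow M T X D y z -> W (balance M y z) <->
    refuting_flow X D y z /\ c0 <= lin g (hits M y).
  move=> pf; have pE : {in T, hits M y =1 p (balance M y z)}.
    by move=> t tT; rewrite (hits_balance pf).
  split.
    move=> [[[_ Wb] Wq] Wc]; rewrite /refuting_flow /refuting !(eq_lin _ pE).
    rewrite /= subr_ge0 in Wq; split => //; split; first by split => // s sT sD; apply: Wb.
    by split => //; apply: lt_le_trans Wc; case: ref0.
  move=> [[[_ fl] []]]; rewrite !(eq_lin _ pE) => Q _ C; split => //; split.
    split; first by apply/flow_coneP; exists y, z.
    by move=> s [sT sD] /=; rewrite fl.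
  by rewrite /= subr_ge0.
have cW : compact W.
  apply: (@subclosed_compact _ _ [set b : {ptws S -> R} | forall s, `[-1, 1]%classic (b s)]).
  - apply: closedI; first apply: closedI; first apply: closedI.
    + exact: closed_cone.
    + apply: closed_bigI => s _; apply: closed_preimage_continuous; last exact: closed_eq.
      exact: proj_ptws_continuous.
    + apply: closed_preimage_continuous; last exact: closed_ge.
      move=> b; apply: (@cvgB R R _ (nbhs b)); last exact: lin_continuous.
      by apply: (@cvgM R _ (nbhs b)); exact: lin_continuous.
    + apply: closed_preimage_continuous; last exact: closed_ge.
      exact: lin_continuous.
  - apply: (@tychonoff S (fun=> R : topologicalType) (fun=> `[-1, 1]%classic)) => s.
    exact: segment_compact.
  - move=> b Wb s; rewrite /= in_itv /=.
    have /flow_coneP[y [z [pf yb]]] : cone (flow_column M T X D) b by case: Wb => [[[]]].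
    have yb' : balance M y z = b by apply: funext.
    rewrite -yb' in Wb; move: Wb => /(WP _ _ pf)[[fl _] _]; rewrite -yb.
    have s01 : 0 <= source M s <= 1 by rewrite /source; case: eqP; rewrite ?lexx ?ler01.
    have [sTD|] := boolP ((s \in T) || (s \in D)); last first.
      by rewrite negb_or => /andP[sT sD]; rewrite fl.2//; lra.
    have := flow_le1 fl sTD; rewrite (balance_out pf sTD) /hits => h01.
    have := inflow_ge0 M s (pf_ge0 pf); lra.
have W0 : W !=set0 by exists (balance M y0 z0); apply/(WP _ _ fl0.1).
have [|b /set_mem Wb minb] :=
  @compact_EVT_min _ R (fun b : {ptws S -> R} => \sum_s b s) W W0 cW.
  apply: continuous_subspaceT.
  apply: (@continuous_big R _ +%R 0 xpredT (@add_continuous R)) => s _.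
  exact: proj_ptws_continuous.
have /flow_coneP[y [z [pf yb]]] : cone (flow_column M T X D) b by case: Wb => [[[]]].
have yb' : balance M y z = b by apply: funext.
rewrite -yb' in Wb minb; move/(WP _ _ pf) : Wb => [fl c0y].
exists y, z; split => // y' z' fl' le'.
rewrite -(sum_balance pf) -(sum_balance fl'.1.1); apply: minb; apply/mem_set.
by apply/(WP _ _ fl'.1.1); split => //; exact: le_trans le'.
Qed.

End refuting_flow.

(** * Moving the stopping mass and cutting flows off *)

Section stop_mass.
Variables (R : realType) (S A : finType) (M : mdp R S A) (T : {set S}).
Implicit Types (y : S -> A -> R) (z p : S -> R) (X D B : {set S}).

(* Half of the runs that stop in [s] take the action [a] first. *)
Lemma push_flow X D y z s a : absorbing M T X -> flow M T X D y z -> z s != 0 ->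
  enabled M s a -> (forall t, 0 < trans M s a t -> t \in X) ->
  exists y' z', [/\ flow M T X D y' z', {in T, hits M y' =1 hits M y},
    \sum_u z' u <= \sum_u z u &
    forall u, z u != 0 \/ (0 < trans M s a u /\ u \notin D) -> z' u != 0].
Proof.
move=> Xabs [pf bal] zs sa aX.
have zs0 : 0 < z s by rewrite lt_neqAle eq_sym zs (pf_stop_ge0 pf).
have /and3P[sT sD sX] : [&& s \notin T, s \notin D & s \in X].
  by apply: contraNT zs => /(pf_stop_supp pf)/eqP.
pose e := z s / 2; have e0 : 0 < e by rewrite divr_gt0.
pose y1 u b : R := (u == s)%:R * (b == a)%:R.
(* Mass that the step moves into [D] ends there and no longer counts as stopping. *)
pose z1 u : R := (u \notin D)%:R * trans M s a u - (u == s)%:R.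
have PT t : t \in T -> trans M s a t = 0.
  move=> tT; apply/eqP; rewrite eq_le trans_ge0 andbT leNgt; apply/negP => /aX /Xabs[].
  by rewrite tT.
have PX t : t \notin X -> trans M s a t = 0.
  by move=> tX; apply/eqP; rewrite eq_le trans_ge0 andbT leNgt; apply: contra tX => /aX.
have out1 u : outflow y1 u = (u == s)%:R.
  by rewrite /outflow -mulr_sumr (bigD1 a)//= eqxx big1 ?addr0 ?mulr1// => b /negPf ->.
have in1 t : inflow M y1 t = trans M s a t.
  rewrite /inflow (bigD1 s)//= [X in _ + X]big1 ?addr0 => [|u /negPf us].
    rewrite (bigD1 a)//= big1 ?addr0 /y1 ?eqxx ?mul1r// => b /negPf ->.
    by rewrite mulr0 mul0r.
  by rewrite big1// => b _; rewrite /y1 us !mul0r.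
have z1E u : 0 <= z u + e * z1 u /\ (z u != 0 \/ (0 < trans M s a u /\ u \notin D) -> 
    0 < z u + e * z1 u).
  have z0 := pf_stop_ge0 pf u; have P0 := trans_ge0 M s a u.
  rewrite /z1; have [->|us] := eqVneq u s.
    rewrite sD mul1r mulrBr mulr1 /e.
    have : 0 <= z s / 2 * trans M s a s by rewrite mulr_ge0// ?trans_ge0// ltW.
    by split => [|_]; lra.
  rewrite /= subr0; split.
    by rewrite addr_ge0// !mulr_ge0// ?ler0n// ltW.
  move=> [zu|[Pu ->]].
    by rewrite ltr_wpDr ?lt_neqAle 1?eq_sym ?zu// !mulr_ge0// ?ler0n// ltW.
  by rewrite ltr_wpDl// mul1r mulr_gt0.
exists (fun u b => 1 * y u b + e * y1 u b), (fun u => 1 * z u + e * z1 u); split.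
- split; last first.
    move=> u uT uD; rewrite balance_lin mul1r bal// /balance out1 in1 /z1 uD /= mul1r; ring.
  split=> [u b|u|u b|u].
  + by rewrite mul1r addr_ge0 ?(pf_ge0 pf)// !mulr_ge0 ?ler0n// ltW.
  + by rewrite mul1r; case: (z1E u).
  + move=> uTD; rewrite (pf_supp pf)// mulr0 add0r /y1.
    have [us|] := eqVneq u s; last by rewrite mul0r mulr0.
    have [ba|] := eqVneq b a; last by rewrite !mulr0.
    by move: uTD; rewrite us ba (negPf sT) (negPf sD) sa.
  + move=> uX; rewrite (pf_stop_supp pf)// mulr0 add0r /z1.
    have /negPf -> : u != s by apply: contraNneq uX => ->; rewrite sT sD.
    apply/eqP; rewrite subr0 mulf_eq0 gt_eqF//=; move: uX.
    rewrite !negb_and !negbK => /or3P[/PT ->|->|/PX ->]; rewrite ?mulr0// ?mul0r//.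
- by move=> t tT; rewrite /hits inflow_lin in1 PT// mulr0 addr0 mul1r.
- rewrite big_split /= -!mulr_sumr mul1r gerDl pmulr_rle0// /z1 sumrB subr_le0.
  rewrite [leRHS](bigD1 s)//= eqxx [X in _ <= _ + X]big1 ?addr0 => [|u /negPf -> //].
  apply: (@le_trans _ _ (\sum_u trans M s a u)); last by rewrite (eqP sa).
  apply: ler_sum => u _.
  by rewrite ler_piMl ?trans_ge0// lern1 leq_b1.
- by move=> u zu; rewrite mul1r gt_eqF//; case: (z1E u) => _; apply.
Qed.

(* [y'] counts only what happens before [B] is entered. *)
Lemma stop_flow X D B y z : flow M T X D y z ->
  (forall s, s \in B = (z s != 0)) ->
  exists y' z', [/\ flow M T X D y' z', flow M T X (D :|: B) y' (fun=> 0),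
    forall s a, y' s a <= y s a & forall s, s \notin B -> z' s = 0].
Proof.
move=> [pf bal] BE.
have Bsupp s : s \in B -> [&& s \notin T, s \notin D & s \in X].
  by rewrite BE; apply: contraNT => /(pf_stop_supp pf)/eqP.
have zB s : s \notin B -> z s = 0 by rewrite BE negbK => /eqP.
have y0 := pf_ge0 pf.
pose x s := outflow y s + z s.
have x0 s : 0 <= x s by rewrite addr_ge0 ?(pf_stop_ge0 pf) ?sumr_ge0.
have xy0 s a : s \notin B -> x s = 0 -> y s a = 0.
  move=> sB; rewrite /x zB// addr0 => /eqP; rewrite psumr_eq0// => /allP /(_ a).
  by rewrite mem_index_enum => /(_ isT)/eqP.
(* [Y v] spreads the visits [v] over the actions as [y] does, except that nothing leaves [B]; [F]
   propagates visits by one step. *)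
pose Y (v : S -> R) s a := if s \in B then 0 else v s / x s * y s a.
pose F v s := if (s \in T) || (s \in D) then 0 else hits M (Y v) s.
have Y_mono v w : (forall s, v s <= w s) -> forall s a, Y v s a <= Y w s a.
  by move=> vw s a; rewrite /Y; case: ifP => // _; rewrite ler_wpM2r// ler_wpM2r ?invr_ge0.
have Yx s a : Y x s a <= y s a.
  rewrite /Y; case: ifPn => // sB; have [xs|xs] := eqVneq (x s) 0.
    by rewrite (xy0 _ a sB xs) mulr0.
  by rewrite divff// mul1r.
have F_mono v w : (forall s, v s <= w s) -> forall s, F v s <= F w s.
  move=> vw s; rewrite /F; case: ifP => // _; rewrite lerD2l; apply: le_inflow.
  exact: Y_mono.
have Fx s : F x s <= x s.
  rewrite /F; case: ifPn => // /norP[sT sD].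
  have := bal s sT sD; rewrite /balance /x /hits => <-.
  by have := le_inflow M s Yx; lra.
(* [F] is monotone and maps [x] below itself, so the iterates decrease to a fixed point, which
   serves as the visits of the flow cut off at [B]. *)
pose it n := iter n F x.
have it_dec s : nonincreasing_seq (fun n => it n s).
  apply/nonincreasing_seqP => n; elim: n s => [|n IH] s /=; first exact: Fx.
  exact: F_mono.
have it0 n s : 0 <= it n s.
  elim: n s => [|n IH] s //=; rewrite /F; case: ifP => // _; apply: hits_ge0 => u a.
  by rewrite /Y; case: ifP => // _; rewrite mulr_ge0// divr_ge0.
have it_cvg s : cvgn (fun n => it n s).
  by apply: nonincreasing_is_cvgn; [exact: it_dec|exists 0 => _ [n _ <-]].
pose v s := limn (fun n => it n s).
have vlim s : it n s @[n --> \oo] --> v s by exact: it_cvg.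
have v0 s : 0 <= v s by apply: limr_ge => //; exact: nearW.
have vx s : v s <= x s.
  by apply: limr_le => //; apply: nearW => n; have := it_dec s 0%N n (leq0n n).
have vF s : v s = F v s.
  have l1 : it n.+1 s @[n --> \oo] --> v s by rewrite (cvg_shiftS (fun n => it n s)).
  have l2 : it n.+1 s @[n --> \oo] --> F v s.
    rewrite /= /F; case: ifP => _; first exact: cvg_cst.
    apply: cvgD; first exact: cvg_cst.
    apply: cvg_sumr => u _; apply: cvg_sumr => a _; apply: cvgM; last exact: cvg_cst.
    rewrite /Y; case: ifP => _; first exact: cvg_cst.
    by apply: cvgM; [apply: cvgM; [exact: vlim|exact: cvg_cst]|exact: cvg_cst].
  exact: (cvg_unique _ l1 l2).
have Yv_ge0 s a : 0 <= Y v s a.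
  by rewrite /Y; case: ifP => // _; rewrite mulr_ge0// divr_ge0.
have Yv_le s a : Y v s a <= y s a by apply: le_trans (Yx s a); exact: Y_mono.
have out_v s : s \notin B -> outflow (Y v) s = v s.
  move=> sB; rewrite /outflow /Y (negPf sB) -mulr_sumr.
  have -> : \sum_a y s a = x s by rewrite /x zB// addr0.
  have [xs|xs] := eqVneq (x s) 0; last by rewrite divfK.
  by rewrite xs mulr0; apply/eqP; rewrite eq_le v0 -xs vx.
have out_B s : s \in B -> outflow (Y v) s = 0.
  by move=> sB; apply: big1 => a _; rewrite /Y sB.
have Ysupp s a : [|| s \in T, s \in D | ~~ enabled M s a] -> Y v s a = 0.
  by move=> sTD; rewrite /Y (pf_supp pf sTD) mulr0; case: ifP.
(* All mass that arrives in [B] stops there; once [B] is added to [D], the same [Y v] is a flow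
   without stopping. *)
exists (Y v), (fun s => if s \in B then v s else 0); split => //.
- split; last first.
    move=> s sT sD; rewrite /balance.
    have := vF s; rewrite /F (negPf sT) (negPf sD) /= /hits => E.
    by case: ifPn => sB; [rewrite out_B//|rewrite out_v//]; lra.
  split=> // [s|s].
    by case: ifP.
  by move=> sX; case: ifPn => // /Bsupp; rewrite (negPf sX).
- split.
    split=> // s a; rewrite inE -orbA => /or4P[sT|sD|sB|sa].
    + by rewrite Ysupp ?sT.
    + by rewrite Ysupp ?sD ?orbT.
    + by rewrite /Y sB.
    + by rewrite Ysupp ?sa ?orbT.
  move=> s sT; rewrite inE negb_or => /andP[sD sB].
  rewrite /balance out_v// addr0; have := vF s.
  by rewrite /F (negPf sT) (negPf sD) /= /hits => E; lra.
- by move=> s /negPf ->.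
Qed.

End stop_mass.

(** * Elimination of stopping *)

Section memoryless_refutation.
Variables (R : realType) (S A : finType) (M : mdp R S A) (T : {set S}).
Variables (f g h : S -> R).
Hypotheses (f_ge0 : forall s, 0 <= f s) (f_le_g : forall s, f s <= g s)
  (h_ge0 : forall s, 0 <= h s).
Implicit Types (y : S -> A -> R) (z p : S -> R) (X D B : {set S}).
Local Notation refuting_flow := (refuting_flow M T f g h).
Local Notation refuting := (refuting T f g h).
Local Notation lin := (lin T).

(** Three extremal choices: [D] maximal, then least stopping probability, then a maximal set [B] of
    stopping states. The last makes [D :|: B] absorbing; the first two then exclude that [B] is
    nonempty. *)
Lemma refuting_flow_nostop X y0 z0 : absorbing M T X ->
  refuting_flow X finset.set0 y0 z0 ->
  exists D y, absorbing M T D /\ refuting_flow X D y (fun=> 0).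
Proof.
move=> Xabs ref0.
pose PD D := `[< absorbing M T D /\ exists y z, refuting_flow X D y z >].
have PD0 : PD finset.set0.
  by apply/asboolP; split; [move=> s; rewrite finset.in_set0|exists y0, z0].
have [D /maxsetP[/asboolP[Dabs [y1 [z1 ref1]]] Dmax] _] := maxset_exists PD0.
have {y0 z0 ref0 PD0 y1 z1 ref1} [y1 [z1 [ref1 min1]]] := min_stop_flow ref1.
(* Every good flow inherits from [y1] the least stopping probability among the refuting flows with
   at least its own [lin g]. *)
pose good y z := [/\ refuting_flow X D y z, lin g (hits M y1) <= lin g (hits M y) &
  \sum_s z s <= \sum_s z1 s].
have good_min y z y' z' : good y z -> refuting_flow X D y' z' ->
    lin g (hits M y) <= lin g (hits M y') -> \sum_s z s <= \sum_s z' s.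
  move=> [_ g1 zz1] ref' g2; apply: le_trans zz1 _.
  by apply: min1 ref' _; exact: le_trans g2.
pose supp z : {set S} := [set s | z s != 0]%SET.
pose PB B := `[< exists y z, good y z /\ B = supp z >].
have PB1 : PB (supp z1) by apply/asboolP; exists y1, z1.
have [B /maxsetP[/asboolP[y [z [gyz BE]]] Bmax] _] := maxset_exists PB1.
have [ref g1 zz1] := gyz; have [[pf bal] refy] := ref.
have inB s : s \in B = (z s != 0) by rewrite BE inE.
have Bsupp s : s \in B -> [&& s \notin T, s \notin D & s \in X].
  by rewrite inB; apply: contraNT => /(pf_stop_supp pf)/eqP.
have [B0|/finset.set0Pn[s0 s0B]] := eqVneq B finset.set0.
  exists D, y; split => //; split => //.
  suff -> : (fun=> 0) = z by [].
  by apply: funext => s; apply/eqP; rewrite eq_sym -[_ == _]negbK -inB B0 finset.in_set0.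
(* Pushing mass from a state of [B] along an action that stays in [X] keeps the flow good, so by
   maximality of [B] the successors outside [D] already lie in [B]. *)
have DBabs : absorbing M T (D :|: B).
  move=> s; rewrite inE => /orP[/Dabs[sT sD]|sB].
    split => //; case: sD => [|[a sa aD]]; first by left.
    by right; exists a => // t /aD tD; rewrite inE tD.
  have /and3P[sT sD sX] := Bsupp s sB; split => //.
  have [_ [ts|[a sa aX]]] := Xabs s sX; [by left|right; exists a => // t Pt].
  rewrite inE; have [//|tD /=] := boolP (t \in D).
  have zs : z s != 0 by rewrite -inB.
  have [y' [z' [fl' hits' le' supp']]] := push_flow Xabs (conj pf bal) zs sa aX.
  have ref' : refuting_flow X D y' z'.
    by split => //; apply: eq_refuting refy => u uT; rewrite hits'.
  have gg' : good y' z'.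
    by split => //; [rewrite (eq_lin _ hits')|exact: le_trans zz1].
  have BB' : supp z' = B.
    apply: Bmax; first by apply/asboolP; exists y', z'.
    by apply/fintype.subsetP => u; rewrite inB inE => zu; apply: supp'; left.
  by rewrite -BB' inE; apply: supp'; right.
exfalso.
have [y2 [z2 [fl2 flB yy2 z2B]]] := stop_flow (conj pf bal) inB.
(* Otherwise [D :|: B] would contradict the maximality of [D]. *)
have nref2 : ~ refuting (hits M y2).
  move=> ref2; have /asboolP PDB : absorbing M T (D :|: B) /\
      exists y z, refuting_flow X (D :|: B) y z.
    by split => //; exists y2, (fun=> 0).
  have := Dmax _ PDB (finset.subsetUl _ _) => /finset.setP /(_ s0).
  rewrite inE s0B orbT => /esym s0D.
  by have := Bsupp s0 s0B; rewrite s0D andbF.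
have hits2 t : hits M y2 t <= hits M y t by rewrite lerD2l; apply: le_inflow.
have hits2_ge0 t : 0 <= hits M y2 t by apply: hits_ge0; exact: pf_ge0 fl2.1.
have [z0 z20] := (pf_stop_ge0 pf, pf_stop_ge0 fl2.1).
have sz2 : 0 <= \sum_s z2 s by exact: sumr_ge0.
case: (@arg_minP _ _ _ s0 (mem B) z s0B) => s1 s1B mins1.
have zs1 : 0 < z s1 by rewrite lt_neqAle z0 andbT eq_sym -inB.
(* Small enough for [c * z2 <= z]: on [B], [z] is at least [z s1] and [z2] at most the denominator,
   which the summand 1 keeps positive. *)
pose c := z s1 / (1 + \sum_s z2 s).
have c0 : 0 < c by rewrite divr_gt0// ltr_pwDl.
have cz s : c * z2 s <= z s.
  have [sB|/z2B ->] := boolP (s \in B); last by rewrite mulr0.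
  apply: le_trans (mins1 s sB); rewrite -mulrA ler_piMr ?(ltW zs1)//.
  rewrite mulrC ler_pdivrMr ?mul1r; last by rewrite ltr_pwDl.
  rewrite (bigD1 s)//= addrCA lerDl addr_ge0// sumr_ge0//.
have [ref3 g3] : refuting (fun t => (1 + c) * hits M y t + - c * hits M y2 t) /\
    lin g (hits M y) <= lin g (fun t => (1 + c) * hits M y t + - c * hits M y2 t).
  by apply: refuting_extrapolate => //; exact: ltW.
pose y3 s a := (1 + c) * y s a + - c * y2 s a.
pose z3 s := (1 + c) * z s + - c * z2 s.
have hits3 t : hits M y3 t = (1 + c) * hits M y t + - c * hits M y2 t.
  by rewrite /hits inflow_lin; ring.
have fl3 : flow M T X D y3 z3.
  split; last by move=> s sT sD; rewrite balance_lin bal// fl2.2//; ring.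
  split=> [s a|s|s a sTD|s sTD].
  - by have := yy2 s a; have := pf_ge0 pf s a; rewrite /y3; nra.
  - by have := cz s; have := z0 s; rewrite /z3; nra.
  - by rewrite /y3 (pf_supp pf)// (pf_supp fl2.1)// !mulr0 addr0.
  - by rewrite /z3 (pf_stop_supp pf)// (pf_stop_supp fl2.1)// !mulr0 addr0.
(* Minimality against the extrapolated flow shows that cutting off at [B] does not increase the
   stopping probability. *)
have sum3 : \sum_s z s <= \sum_s z3 s.
  have ref3' : refuting (hits M y3) by apply: eq_refuting ref3 => t _; rewrite hits3.
  apply: good_min gyz (conj fl3 ref3') _.
  by rewrite (@eq_lin _ _ T g (hits M y3) _ (fun t _ => hits3 t)).
have le_sum : \sum_s z2 s <= \sum_s z s.
  move: sum3; rewrite big_split /= -!mulr_sumr; nra.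
(* Both flows have total mass 1, and [y2] neither stops more nor arrives anywhere more than [y]. So
   they agree on [T], although [y] is refuting and [y2] is not. *)
have eq_hits : {in T, hits M y =1 hits M y2}.
  move=> t tT; apply/eqP; rewrite eq_le hits2 andbT leNgt; apply/negP => lt_t.
  have := flow_mass (conj pf bal); rewrite -(flow_mass fl2).
  rewrite (bigD1 t (P := fun s => _ || _)) ?tT//=.
  rewrite [in RHS](bigD1 t (P := fun s => _ || _)) ?tT//=.
  have : \sum_(s | ((s \in T) || (s \in D)) && (s != t)) hits M y2 s <=
    \sum_(s | ((s \in T) || (s \in D)) && (s != t)) hits M y s by apply: ler_sum.
  lra.
by apply: nref2; apply: eq_refuting refy.
Qed.

(* [x] and [y] stand for the masses that an arbitrary scheduler has in a state,
   respectively moves by an action, before the first visit to [T]. *)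
Lemma memoryless_refutation (x : nat -> S -> R) (y : nat -> S -> A -> R) p :
  (forall n s a, 0 <= y n s a) ->
  (forall n s a, (s \in T) || ~~ enabled M s a -> y n s a = 0) ->
  (forall s, x 0 s = source M s) ->
  (forall n s, x n.+1 s = inflow M (y n) s) ->
  (forall n s, s \notin T -> ~~ terminal M s -> outflow (y n) s = x n s) ->
  (forall t, t \in T -> (\sum_(i < n) x i t) @[n --> \oo] --> p t) ->
  refuting p ->
  exists d q, [/\ policy M d,
    forall t, t \in T -> (\sum_(i < n) mass M T d i t) @[n --> \oo] --> q t &
    refuting q].
Proof.
move=> y0 ys x0 xS yout xp refp.
have [X Xabs [y1 [z1 [fl1 h1]]]] := flow_limit y0 ys x0 xS yout xp.
have [|D [y2 [Dabs [fl2 ref2]]]] := @refuting_flow_nostop X y1 z1 Xabs.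
  by split => //; apply: eq_refuting refp => t tT; rewrite h1.
have [d dpol dlim] := flow_policy Dabs fl2.
by exists d, (hits M y2); split.
Qed.

End memoryless_refutation.

(** * Expectations along histories *)

Section histories.
Variables (R : realType) (S A : finType) (M : mdp R S A).
Variables (sigma : scheduler M) (s : S).
Local Notation hist := (seq (A * S)).
Local Notation ends h := (last_state s h).

Definition step (G : hist -> R) (h : hist) : R :=
  \sum_a \sum_t sigma s h a * trans M (ends h) a t * G (rcons h (a, t)).

(* In a terminal state the history does not grow any more. *)
Fixpoint expect (n : nat) (G : hist -> R) (h : hist) : R :=
  if n is m.+1 then (terminal M (ends h))%:R * expect m G h + step (expect m G) h
  else G h.

(* Only the histories that grow at every step are counted. *)
Fixpoint exact_expect (n : nat) (G : hist -> R) : hist -> R :=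
  if n is m.+1 then step (exact_expect m G) else G.

Lemma ends_rcons (h : hist) x : ends (rcons h x) = x.2.
Proof. by rewrite /last_state map_rcons last_rcons. Qed.

Lemma prefix_prob_rcons p x :
  prefix_prob sigma s (rcons p x) = prefix_prob sigma s p * step_prob sigma s (pmap id p) x.
Proof.
rewrite /prefix_prob size_rcons big_ord_recr /= nth_rcons ltnn eqxx -cats1.
rewrite take_size_cat//; congr (_ * _); apply: eq_bigr => i _.
by rewrite nth_cat ltn_ord takel_cat// ltnW.
Qed.

Lemma pmap_id_rcons (p : seq (option (A * S))) x :
  pmap id (rcons p x) = if x is Some y then rcons (pmap id p) y else pmap id p.
Proof. by rewrite -cats1 pmap_cat; case: x => [y|] /=; rewrite ?cats1 ?cats0. Qed.

Lemma step_prob_sum_step (G : hist -> R) p :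
  \sum_x step_prob sigma s (pmap id p) x * G (pmap id (rcons p x)) =
  (terminal M (ends (pmap id p)))%:R * G (pmap id p) + step G (pmap id p).
Proof.
rewrite (bigD1 None) //= pmap_id_rcons; congr (_ + _).
rewrite (reindex_omap Some id) /=; last by case.
rewrite (eq_bigl predT) => [|y]; last by rewrite eqxx.
rewrite /step pair_bigA /=; apply: eq_bigr => -[a t] _ /=.
by rewrite pmap_id_rcons.
Qed.

Lemma measurable_history (f : pred hist) n :
  measurable ([set w | f (history w n)] : set (sequence_space (A * S)%type)).
Proof. exact: (@measurable_prefix _ n (fun p => f (pmap id p))). Qed.

(** The cylinder is split according to the next step; [expect] continues from the history of [p].
    This links the measure to the recursion. *)
Lemma path_measure_history (f : pred hist) k p :
  path_measure sigma s (cylinder p `&` [set w | f (history w (size p + k))]) =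
  (prefix_prob sigma s p * expect k (fun h => (f h)%:R) (pmap id p))%:E.
Proof.
elim: k p => [|k IH] p /=.
  have -> : cylinder p `&` [set w | f (history w (size p + 0))] =
      if f (pmap id p) then cylinder p else set0.
    apply/seteqP; split => w.
      by move=> [wp]; rewrite /= addn0 /history wp => ->.
    by case: ifP => // fp wp; split => //=; rewrite addn0 /history wp.
  by case: ifP => _; rewrite ?measure0 ?mulr0// mulr1 path_measure_cylinder.
pose E : set (sequence_space (A * S)%type) := [set w | f (history w (size p + k.+1))].
pose F (x : option (A * S)) : set (sequence_space (A * S)%type) := cylinder (rcons p x) `&` E.
have -> : cylinder p `&` E = \bigcup_(x in [set` index_enum (option (A * S) : finType)]) F x.
  apply/seteqP; split => w.
    move=> [wp wE]; exists (w (size p)); first by rewrite /= mem_index_enum.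
    split => //.
    by rewrite /cylinder /= size_rcons mkseqS wp.
  move=> [x _ [wp wE]]; split => //; move: wp; rewrite /cylinder /= size_rcons mkseqS.
  by move=> /rcons_inj[].
rewrite measure_fin_bigcup//; last 2 first.
- apply/trivIsetP => x y _ _; apply: contra_neqP => /eqP/set0P[w [[wx _] [wy _]]].
  move: wx wy; rewrite /cylinder /= !size_rcons => -> /rcons_inj[].
  by [].
- move=> x _; apply: measurableI; first exact: measurable_cylinder.
  exact: measurable_history.
rewrite -fsbig_seq ?index_enum_uniq// -step_prob_sum_step mulr_sumr -sumEFin.
apply: eq_bigr => x _.
by rewrite mulrA -prefix_prob_rcons -IH size_rcons addSnnS.
Qed.

Lemma Pr_history (f : pred hist) n :
  Pr sigma s [set w | f (history w n)] = expect n (fun h => (f h)%:R) [::].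
Proof.
have := path_measure_history f n [::]; rewrite /= add0n /Pr => H.
have -> : [set w | f (history w n)] = cylinder [::] `&` [set w | f (history w n)].
  by apply/seteqP; split => w //= [].
by rewrite H /= /prefix_prob big_ord0 mul1r.
Qed.

(** Continuity from below: [E] is the increasing union of the events that [f] holds after [n]
    steps. *)
Lemma Pr_limit (f : pred hist) (E : set (sequence_space (A * S)%type)) :
  (forall h x, f h -> f (rcons h x)) ->
  (forall w, E w <-> exists n, f (history w n)) ->
  expect n (fun h => (f h)%:R) [::] @[n --> \oo] --> Pr sigma s E.
Proof.
move=> fmono EP; pose F n : set (sequence_space (A * S)%type) := [set w | f (history w n)].
have EE : E = \bigcup_n F n.
  by apply/seteqP; split => w; [move=> /EP[n]; exists n|move=> [n _ fn]; apply/EP; exists n].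
have mE : measurable E.
  by rewrite EE; apply: bigcup_measurable => n _; exact: measurable_history.
have Fnd : nondecreasing_seq F.
  apply/nondecreasing_seqP => n; apply/subsetPset => w; rewrite /F /= /history mkseqS.
  by rewrite pmap_id_rcons; case: (w n) => // x; exact: fmono.
have := @nondecreasing_cvg_mu _ _ _ (path_measure sigma s) F
  (measurable_history f) _ Fnd.
rewrite -EE => /(_ mE) lim; apply: eq_cvgn (fine_cvg _); last first.
  rewrite /Pr fineK ?fin_num_measure//; exact: lim.
by move=> n /=; rewrite -Pr_history.
Qed.

End histories.

Section expectations.
Variables (R : realType) (S A : finType) (M : mdp R S A).
Variables (sigma : scheduler M) (s : S).
Local Notation hist := (seq (A * S)).
Local Notation ends h := (last_state s h).
Local Notation step := (step sigma s).
Local Notation expect := (expect sigma s).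
Local Notation exact_expect := (exact_expect sigma s).
Implicit Types (G F : hist -> R) (h : hist).

Lemma step_ge0 G h : (forall h', 0 <= G h') -> 0 <= step G h.
Proof.
by move=> G0; do 2!apply: sumr_ge0 => ? _; rewrite !mulr_ge0 ?choice_ge0 ?trans_ge0.
Qed.

Lemma le_step G F h : (forall x, G (rcons h x) <= F (rcons h x)) -> step G h <= step F h.
Proof.
move=> GF; do 2!apply: ler_sum => ? _.
by rewrite ler_wpM2l// mulr_ge0 ?choice_ge0 ?trans_ge0.
Qed.

Lemma eq_step G F h : (forall x, G (rcons h x) = F (rcons h x)) -> step G h = step F h.
Proof. by move=> GF; do 2!apply: eq_bigr => ? _; rewrite GF. Qed.

Lemma step_terminal G h : terminal M (ends h) -> step G h = 0.
Proof.
move=> /forallP th; rewrite /step big1// => a _; rewrite big1// => t _.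
by rewrite choice_enabled// !mul0r.
Qed.

Lemma step_last (g : S -> R) G h : (forall a t, G (rcons h (a, t)) = g t) ->
  step G h = \sum_a sigma s h a * \sum_t trans M (ends h) a t * g t.
Proof.
move=> Gg; apply: eq_bigr => a _; rewrite mulr_sumr; apply: eq_bigr => t _.
by rewrite Gg mulrA.
Qed.

Lemma step_const (c : R) h : ~~ terminal M (ends h) -> step (fun=> c) h = c.
Proof.
move=> th; rewrite (@step_last (fun=> c))//.
transitivity (\sum_a sigma s h a * c); last by rewrite -mulr_suml choice_sum// mul1r.
apply: eq_bigr => a _; rewrite -mulr_suml.
have [/eqP ->|na] := boolP (enabled M (ends h) a); first by rewrite mul1r.
by rewrite choice_enabled// !mul0r.
Qed.

Lemma step_sum (I : finType) (P : pred I) (G : I -> hist -> R) h :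
  step (fun h' => \sum_(i | P i) G i h') h = \sum_(i | P i) step (G i) h.
Proof.
rewrite /step [RHS]exchange_big; apply: eq_bigr => a _ /=.
by rewrite [RHS]exchange_big; apply: eq_bigr => t _ /=; rewrite mulr_sumr.
Qed.

Lemma step_scale c G h : step (fun h' => c * G h') h = c * step G h.
Proof.
rewrite /step mulr_sumr; apply: eq_bigr => a _ /=.
by rewrite mulr_sumr; apply: eq_bigr => t _ /=; rewrite mulrCA.
Qed.

Lemma expect_terminal n G h : terminal M (ends h) -> expect n G h = G h.
Proof.
by move=> th; elim: n => //= n ->; rewrite step_terminal// th mul1r addr0.
Qed.

Lemma expect_nonterminal n G h : ~~ terminal M (ends h) ->
  expect n.+1 G h = step (expect n G) h.
Proof. by move=> /negPf th /=; rewrite th mul0r add0r. Qed.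

Lemma expect_const n c h : expect n (fun=> c) h = c.
Proof.
elim: n h => //= n IH h; have [th|th] := boolP (terminal M (ends h)).
  by rewrite step_terminal// IH mul1r addr0.
by rewrite mul0r add0r -[RHS](step_const c th); apply: eq_step => x; rewrite IH.
Qed.

Lemma expect_ext n G F h : (forall h', G (h ++ h') = F (h ++ h')) ->
  expect n G h = expect n F h.
Proof.
elim: n h => [|n IH] h GF /=; first by have := GF [::]; rewrite cats0.
rewrite IH//; congr (_ + _); apply: eq_step => x.
by rewrite IH// => h'; rewrite cat_rcons.
Qed.

Lemma le_expect n G F h : (forall h', G h' <= F h') -> expect n G h <= expect n F h.
Proof.
move=> GF; elim: n h => [|n IH] h //=.
by rewrite lerD ?ler_wpM2l ?ler0n// le_step.
Qed.

Lemma expectD n G F h :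
  expect n (fun h' => G h' + F h') h = expect n G h + expect n F h.
Proof.
elim: n h => //= n IH h; rewrite IH mulrDr addrACA; congr (_ + _).
rewrite /step -big_split; apply: eq_bigr => a _ /=.
by rewrite -big_split; apply: eq_bigr => t _ /=; rewrite IH mulrDr.
Qed.

Lemma expect_mono G h : (forall h' x, G h' <= G (rcons h' x)) ->
  nondecreasing_seq (fun n => expect n G h).
Proof.
move=> Gm; apply/nondecreasing_seqP => n; elim: n h => [|n IH] h /=.
  have [th|th] := boolP (terminal M (ends h)).
    by rewrite mul1r lerDl step_terminal.
  by rewrite mul0r add0r -[leLHS](step_const _ th) le_step.
rewrite lerD//; first by rewrite ler_wpM2l ?ler0n// IH.
by apply: le_step => x; rewrite IH.
Qed.

(** The definition splits off the first step; splitting off the last one gives the forward recursion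
    of [first_mass]. *)
Lemma exact_expect_last n G h :
  exact_expect n.+1 G h = exact_expect n (step G) h.
Proof. by elim: n h => //= n IH h; apply: eq_step => x; exact: IH. Qed.

Lemma exact_expect_ge0 n G h : (forall h', 0 <= G h') -> 0 <= exact_expect n G h.
Proof. by move=> G0; elim: n h => //= n IH h; exact: step_ge0. Qed.

Lemma exact_expect_sum (I : finType) (P : pred I) n (G : I -> hist -> R) h :
  exact_expect n (fun h' => \sum_(i | P i) G i h') h = \sum_(i | P i) exact_expect n (G i) h.
Proof.
by elim: n h => //= n IH h; rewrite -step_sum; apply: eq_step => x; rewrite IH.
Qed.

Lemma exact_expect_scale n c G h :
  exact_expect n (fun h' => c * G h') h = c * exact_expect n G h.
Proof. by elim: n h => //= n IH h; rewrite -step_scale; apply: eq_step => x; rewrite IH. Qed.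

Lemma eq_exact_expect n G F h : G =1 F -> exact_expect n G h = exact_expect n F h.
Proof. by move=> /funext ->. Qed.

Definition visits (U : {set S}) h : bool := has (mem U) (s :: map snd h).
(** The current state does not count: [~~ visited U h] and [ends h \in U] together say that [h] ends
    with its first visit to [U]. *)
Definition visited (U : {set S}) h : bool := has (mem U) (belast s (map snd h)).

Lemma visitsE U h : visits U h = visited U h || (ends h \in U).
Proof. by rewrite /visits lastI has_rcons orbC. Qed.

Lemma visited_rcons U h x : visited U (rcons h x) = visits U h.
Proof. by rewrite /visited map_rcons belast_rcons. Qed.

Lemma visits_rcons U h x : visits U (rcons h x) = visits U h || (x.2 \in U).
Proof. by rewrite visitsE visited_rcons ends_rcons. Qed.

Lemma visits_cat U h h' : visits U h -> visits U (h ++ h').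
Proof. by rewrite /visits map_cat -cat_cons has_cat => ->. Qed.

Lemma visitedU U V h : visited (U :|: V) h = visited U h || visited V h.
Proof.
by rewrite /visited -has_predU; apply: eq_has => u; rewrite /= inE.
Qed.

Lemma visitsU U V h : visits (U :|: V) h = visits U h || visits V h.
Proof. by rewrite /visits -has_predU; apply: eq_has => u; rewrite /= inE. Qed.

Lemma diamond_visits U w : diamond s U w <-> exists n, visits U (history w n).
Proof.
split=> [[n [t [st tU]]]|[n /hasP[t tw tU]]].
  exists n; apply/hasP; exists t => //; case: n st => [[->]|n] /=; first exact: mem_head.
  case wn : (w n) => [x|//] /= [<-]; rewrite inE; apply/orP; right; apply: map_f.
  by rewrite mem_pmap map_id -wn; apply/mapP; exists n; rewrite ?mem_iota ?add0n/=.
move: tw; rewrite inE => /orP[/eqP ts|/mapP[x]]; first by exists 0%N, s; rewrite -ts.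
rewrite mem_pmap map_id => /mapP[m _ wm] tx.
by exists m.+1, t; split => //=; rewrite -wm tx.
Qed.

Lemma Pr_diamond_limit U :
  expect n (fun h => (visits U h)%:R) [::] @[n --> \oo] --> Pr sigma s (diamond s U).
Proof.
apply: Pr_limit; last by move=> w; exact: diamond_visits.
by move=> h x; rewrite visits_rcons => ->.
Qed.

Lemma Pr_diamondI_limit U V :
  expect n (fun h => (visits U h && visits V h)%:R) [::] @[n --> \oo] -->
  Pr sigma s (diamond s U `&` diamond s V).
Proof.
apply: (@Pr_limit _ _ _ _ _ _ (fun h => visits U h && visits V h)).
  by move=> h x; rewrite !visits_rcons => /andP[-> ->].
have mono W w n k : visits W (history w n) -> visits W (history w (n + k)).
  move=> Wn; rewrite /history /mkseq iotaD map_cat pmap_cat; exact: visits_cat.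
move=> w; split=> [[/diamond_visits[n Un] /diamond_visits[k Vk]]|[n /andP[Un Vn]]].
  by exists (n + k)%N; rewrite mono//= addnC mono.
by split; apply/diamond_visits; exists n.
Qed.

(** * First visits to a set *)

Section first_visit.
Variable T : {set S}.

Definition first_visit_at (t : S) h : R := (~~ visited T h && (ends h == t))%:R.
Definition first_reward (k : S -> R) h : R :=
  (~~ visited T h && (ends h \in T))%:R * k (ends h).

Lemma exact_first_reward_visited k n h : visited T h ->
  exact_expect n (first_reward k) h = 0.
Proof.
elim: n h => [|n IH] h vh /=; first by rewrite /first_reward vh mul0r.
rewrite /step big1// => a _; rewrite big1// => t _.
by rewrite IH ?mulr0// visited_rcons visitsE vh.
Qed.

Lemma sum_exact_first_reward k n h : ~~ visited T h ->
  \sum_(i < n.+1) exact_expect i (first_reward k) h =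
  if ends h \in T then k (ends h)
  else step (fun h' => \sum_(i < n) exact_expect i (first_reward k) h') h.
Proof.
move=> vh; rewrite big_ord_recl /= {1}/first_reward vh /=.
case: ifPn => hT; last by rewrite mul0r add0r step_sum.
rewrite mul1r big1 ?addr0// => i _ /=.
rewrite /step big1// => a _; rewrite big1// => t _.
by rewrite exact_first_reward_visited ?mulr0// visited_rcons visitsE hT orbT.
Qed.

(** Once [T] is entered the expected value of [G] is settled, so it can be collected at the first
    visit, which happens at one of the times 0 to [n]. *)
Lemma expect_first_reward (k : S -> R) G n h : ~~ visited T h ->
  (forall h', ~~ visited T h' -> ends h' \in T -> forall m, expect m G h' = k (ends h')) ->
  (forall h', ~~ visits T h' -> G h' = 0) ->
  expect n G h = \sum_(i < n.+1) exact_expect i (first_reward k) h.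
Proof.
move=> vh GT G0; elim: n h vh => [|n IH] h vh; rewrite sum_exact_first_reward//.
  case: ifPn => hT; first exact: (GT h vh hT 0%N).
  rewrite /= G0 ?visitsE ?negb_or ?vh//.
  have [th|th] := boolP (terminal M (ends h)); first by rewrite step_terminal.
  by rewrite -[LHS](step_const 0 th); apply: eq_step => x; rewrite big_ord0.
case: ifPn => hT; first exact: GT.
have vTh : ~~ visits T h by rewrite visitsE negb_or vh.
have [th|th] := boolP (terminal M (ends h)).
  by rewrite step_terminal// expect_terminal// G0.
by rewrite expect_nonterminal//; apply: eq_step => x; rewrite IH// visited_rcons.
Qed.

Lemma expect_first_reward_le (k : S -> R) G n h : ~~ visited T h ->
  (forall h', ~~ visited T h' -> ends h' \in T -> forall m, expect m G h' <= k (ends h')) ->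
  (forall h', ~~ visits T h' -> G h' = 0) ->
  expect n G h <= \sum_(i < n.+1) exact_expect i (first_reward k) h.
Proof.
move=> vh GT G0; elim: n h vh => [|n IH] h vh; rewrite sum_exact_first_reward//.
  case: ifPn => hT; first exact: (GT h vh hT 0%N).
  rewrite /= G0 ?visitsE ?negb_or ?vh//.
  have [th|th] := boolP (terminal M (ends h)); first by rewrite step_terminal.
  by rewrite -[leLHS](step_const 0 th); apply: le_step => x; rewrite big_ord0.
case: ifPn => hT; first exact: GT.
have vTh : ~~ visits T h by rewrite visitsE negb_or vh.
have [th|th] := boolP (terminal M (ends h)).
  by rewrite step_terminal// expect_terminal// G0.
by rewrite expect_nonterminal//; apply: le_step => x; rewrite IH// visited_rcons.
Qed.

(** A lower bound on the reward holds only in the limit, so the induction runs on [l], which at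
    nonterminal histories equals its own one-step expectation. *)
Lemma expect_first_reward_ge (k : S -> R) G (l : hist -> R) n h : ~~ visited T h ->
  (forall h', 0 <= G h') ->
  (forall h', expect m G h' @[m --> \oo] --> l h') ->
  (forall h', ~~ visited T h' -> ends h' \in T -> k (ends h') <= l h') ->
  \sum_(i < n) exact_expect i (first_reward k) h <= l h.
Proof.
move=> vh G0 Gl kl; elim: n h vh => [|n IH] h vh.
  rewrite big_ord0; apply: (cvgr_to_ge (Gl h)); apply: nearW => m.
  by rewrite -(expect_const m 0 h) le_expect.
rewrite sum_exact_first_reward//; case: ifPn => hT; first exact: kl.
have [th|th] := boolP (terminal M (ends h)).
  rewrite step_terminal//; apply: (cvgr_to_ge (Gl h)); apply: nearW => m.
  by rewrite -(expect_const m 0 h) le_expect.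
have -> : l h = step l h.
  have Gl1 : expect m.+1 G h @[m --> \oo] --> l h.
    by rewrite (cvg_shiftS (fun m => expect m G h)).
  have Gl2 : step (expect m G) h @[m --> \oo] --> step l h.
    by apply: cvg_sumr => a _; apply: cvg_sumr => t _; apply: cvgM; [exact: cvg_cst|exact: Gl].
  have {}Gl2 : expect m.+1 G h @[m --> \oo] --> step l h.
    by apply: eq_cvgn Gl2 => m; rewrite expect_nonterminal.
  exact: (cvg_unique _ Gl1 Gl2).
by apply: le_step => x; apply: IH; rewrite visited_rcons visitsE negb_or vh.
Qed.

Definition first_mass (n : nat) (t : S) : R := exact_expect n (first_visit_at t) [::].

Lemma exact_first_reward k n :
  exact_expect n (first_reward k) [::] = \sum_(t in T) k t * first_mass n t.
Proof.
transitivity (exact_expect n (fun h => \sum_(t in T) k t * first_visit_at t h) [::]).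
  apply: eq_exact_expect => h; rewrite /first_reward /first_visit_at.
  have [hT|hT] := boolP (ends h \in T); last first.
    rewrite andbF mul0r big1// => t tT; suff /negPf -> : ends h != t by rewrite andbF mulr0.
    by apply: contraNneq hT => ->.
  rewrite (bigD1 (ends h))//= eqxx andbT big1 ?addr0 1?mulrC// => t /andP[_].
  by rewrite eq_sym => /negPf ->; rewrite andbF mulr0.
by rewrite exact_expect_sum; apply: eq_bigr => t _; rewrite exact_expect_scale.
Qed.

(** Together with [first_mass] these are the masses of an arbitrary scheduler before its first visit
    to [T], in the form that [memoryless_refutation] takes. *)
Definition first_flow (n : nat) (u : S) (a : A) : R :=
  exact_expect n (fun h => (~~ visits T h && (ends h == u))%:R * sigma s h a) [::].

Lemma first_flow_ge0 n u a : 0 <= first_flow n u a.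
Proof. by apply: exact_expect_ge0 => h; rewrite mulr_ge0 ?ler0n ?choice_ge0. Qed.

Lemma exact_expect0 n G : (forall h, G h = 0) -> exact_expect n G [::] = 0.
Proof.
move=> G0; rewrite -[RHS](mul0r (exact_expect n G [::])) -exact_expect_scale.
by apply: eq_exact_expect => h; rewrite G0 mul0r.
Qed.

Lemma first_flow_supp n u a : (u \in T) || ~~ enabled M u a -> first_flow n u a = 0.
Proof.
move=> uTa; apply: exact_expect0 => h; rewrite visitsE negb_or.
have [hu|] := eqVneq (ends h) u; last by rewrite andbF mul0r.
case/orP: uTa => [uT|ua]; first by rewrite hu uT andbF mul0r.
by rewrite choice_enabled ?mulr0// hu.
Qed.

Lemma first_mass0 t : first_mass 0 t = (t == s)%:R.
Proof. by rewrite /first_mass /= /first_visit_at /visited /= eq_sym. Qed.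

Lemma first_massS n t : first_mass n.+1 t = inflow M (first_flow n) t.
Proof.
rewrite /first_mass exact_expect_last /inflow.
transitivity (exact_expect n (fun h => \sum_u \sum_a
    trans M u a t * ((~~ visits T h && (ends h == u))%:R * sigma s h a)) [::]).
  apply: eq_exact_expect => h; rewrite (bigD1 (ends h))//= [X in _ + X]big1 ?addr0; last first.
    move=> u /negPf uh; rewrite big1// => a _.
    by rewrite eq_sym uh andbF mul0r mulr0.
  rewrite eqxx andbT (@step_last (fun t' => (~~ visits T h && (t' == t))%:R)); last first.
    by move=> a t'; rewrite /first_visit_at visited_rcons ends_rcons.
  apply: eq_bigr => a _; rewrite (bigD1 t)//= eqxx andbT big1 ?addr0; last first.
    by move=> t' /negPf ->; rewrite andbF mulr0.
  by ring.
rewrite exact_expect_sum; apply: eq_bigr => u _.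
by rewrite exact_expect_sum; apply: eq_bigr => a _; rewrite exact_expect_scale mulrC.
Qed.

Lemma first_flow_out n u : u \notin T -> ~~ terminal M u ->
  outflow (first_flow n) u = first_mass n u.
Proof.
move=> uT ut; rewrite /outflow /first_flow -exact_expect_sum; apply: eq_exact_expect => h.
rewrite -mulr_sumr /first_visit_at visitsE negb_or.
have [hu|] := eqVneq (ends h) u; last by rewrite !andbF mul0r.
by rewrite hu uT !andbT choice_sum ?mulr1// hu.
Qed.

(** Only histories before the first visit to [T] enter, so this covers a scheduler that changes its
    behaviour afterwards. *)
Lemma first_flow_memoryless (d : S -> A -> R) n :
  (forall h a, ~~ visits T h -> sigma s h a = d (ends h) a) ->
  forall u a, first_flow n u a = (u \notin T)%:R * first_mass n u * d u a.
Proof.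
move=> sd u a; rewrite mulrAC -exact_expect_scale; apply: eq_exact_expect => h.
rewrite /first_visit_at visitsE negb_or.
have [hu|] := eqVneq (ends h) u; last by rewrite !andbF mul0r mulr0.
rewrite hu !andbT; have [uT|uT] := boolP (u \in T); first by rewrite andbF !mul0r.
rewrite andbT mul1r; case vh: (visited T h); first by rewrite mul0r mulr0.
by rewrite sd ?visitsE ?vh ?hu//= mulrC.
Qed.

(** A reward of 1 at the first visit is collected at most once. *)
Lemma first_mass_le1 n : \sum_(i < n) \sum_(t in T) first_mass i t <= 1.
Proof.
have E i : \sum_(t in T) first_mass i t = exact_expect i (first_reward (fun=> 1)) [::].
  by rewrite exact_first_reward; apply: eq_bigr => t _; rewrite mul1r.
under eq_bigr do rewrite E.
apply: (@expect_first_reward_ge (fun=> 1) (fun=> 1) (fun=> 1)) => // h.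
have -> : (fun m => expect m (fun=> 1) h) = fun=> 1.
  by apply: funext => m; rewrite expect_const.
exact: cvg_cst.
Qed.

Lemma first_mass_ge0 n t : 0 <= first_mass n t.
Proof. by apply: exact_expect_ge0 => h; exact: ler0n. Qed.

Lemma first_mass_cvg : exists p : S -> R, forall t, t \in T ->
  (\sum_(i < n) first_mass i t) @[n --> \oo] --> p t.
Proof.
exists (fun t => limn (fun n => \sum_(i < n) first_mass i t)) => t tT.
apply: nondecreasing_is_cvgn.
  by apply/nondecreasing_seqP => n; rewrite big_ord_recr lerDl first_mass_ge0.
exists 1 => _ [n _ <-]; apply: le_trans (first_mass_le1 n).
apply: ler_sum => i _; rewrite (bigD1 t)//= lerDl; apply: sumr_ge0 => u _.
exact: first_mass_ge0.
Qed.

Lemma sum_first_reward_cvg k (p : S -> R) :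
  (forall t, t \in T -> (\sum_(i < n) first_mass i t) @[n --> \oo] --> p t) ->
  \sum_(i < n) exact_expect i (first_reward k) [::] @[n --> \oo] --> lin T k p.
Proof.
move=> fp; apply: eq_cvgn (@cvg_sumr _ _ (mem T) _ \oo _
   (fun t n => k t * \sum_(i < n) first_mass i t) _ (fun t tT => cvgM (cvg_cst (k t)) (fp t tT))).
move=> n; under eq_bigr do rewrite exact_first_reward.
by rewrite exchange_big; apply: eq_bigr => t _; rewrite mulr_sumr.
Qed.

End first_visit.

End expectations.

(** * Causes and minimal reachability probabilities *)

Section reachability.
Variables (R : realType) (S A : finType) (M : mdp R S A).
Local Notation hist := (seq (A * S)).
Implicit Types h : hist.

Section fixed_scheduler.
Variables (sigma : scheduler M) (s : S).
Local Notation ends h := (last_state s h).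
Local Notation expect := (expect sigma s).
Local Notation step := (step sigma s).
Local Notation visits := (visits s).
Local Notation visited := (visited s).

Lemma expect_bool n (f : pred hist) h : 0 <= expect n (fun h' => (f h')%:R) h <= 1.
Proof.
apply/andP; split.
  have ge0 : expect n (fun=> 0) h <= expect n (fun h' => (f h')%:R) h.
    by apply: le_expect => h'; exact: ler0n.
  by rewrite expect_const in ge0.
have le1 : expect n (fun h' => (f h')%:R) h <= expect n (fun=> 1) h.
  by apply: le_expect => h'; rewrite lern1 leq_b1.
by rewrite expect_const in le1.
Qed.

Lemma expect_bool_cvg (f : pred hist) h : (forall h' x, f h' -> f (rcons h' x)) ->
  cvgn (fun n => expect n (fun h' => (f h')%:R) h).
Proof.
move=> fm; apply: nondecreasing_is_cvgn.
  apply: expect_mono => h' x; rewrite ler_nat; have := fm h' x.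
  by case: (f h') => // ->.
by exists 1 => _ [n _ <-]; have /andP[] := expect_bool n f h.
Qed.

Lemma expect_visited n U h : visits U h -> expect n (fun h' => (visits U h')%:R) h = 1.
Proof.
move=> Uh; transitivity (expect n (fun=> 1) h); last exact: expect_const.
by apply: expect_ext => h'; rewrite visits_cat.
Qed.

(** A superharmonic function that is at least 1 on [Eff] bounds the reachability probability. The
    invariant [I] allows the scheduler to be considered only from some point on. *)
Lemma expect_visits_le (Eff : {set S}) (w : S -> R) (I : pred hist) :
  (forall u, 0 <= w u) -> (forall u, u \in Eff -> 1 <= w u) ->
  (forall h x, I h -> I (rcons h x)) ->
  (forall h, I h -> ~~ terminal M (ends h) -> ends h \notin Eff ->
     \sum_a sigma s h a * \sum_t trans M (ends h) a t * w t <= w (ends h)) ->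
  forall n h, I h -> ~~ visited Eff h ->
    expect n (fun h' => (visits Eff h')%:R) h <= w (ends h).
Proof.
move=> w0 w1 Irec Iw; elim=> [|n IH] h Ih vh.
  by rewrite /= visitsE (negPf vh) /=; case: (boolP (ends h \in Eff)) => [/w1|_].
have [hE|hE] := boolP (ends h \in Eff).
  by rewrite expect_visited ?w1// visitsE hE orbT.
have [th|th] := boolP (terminal M (ends h)).
  by rewrite expect_terminal// visitsE (negPf vh) (negPf hE).
rewrite expect_nonterminal//; apply: le_trans (Iw h Ih th hE).
rewrite -(@step_last _ _ _ _ sigma s w (fun h' => w (ends h'))) => [|a t]; last first.
  by rewrite ends_rcons.
apply: le_step => x; apply: IH; first exact: Irec.
by rewrite visited_rcons visitsE negb_or vh.
Qed.

(** * The GPR condition in terms of first visits *)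

Section causes.
Variables (Eff Cause : {set S}).
Hypotheses (Eff_terminal : forall e, e \in Eff -> terminal M e)
  (Cause_Eff : Cause \subset ~: Eff).
Let T := Cause :|: Eff.
Variable p : S -> R.
Hypothesis p_lim : forall t, t \in T ->
  (\sum_(i < n) first_mass sigma s T i t) @[n --> \oo] --> p t.
Local Notation in_ U := (fun t : S => (t \in U)%:R : R).
Local Notation Pr := (Pr sigma s).
Local Notation diamond := (diamond s).

Let notCause e : e \in Eff -> e \notin Cause.
Proof. by move=> eE; apply/negP => /(fintype.subsetP Cause_Eff); rewrite inE eE. Qed.

Let visitedT h : ~~ visited T h -> ~~ visited Cause h /\ ~~ visited Eff h.
Proof. by rewrite visitedU negb_or => /andP. Qed.

Let visitsT h : ~~ visits T h -> ~~ visits Cause h /\ ~~ visits Eff h.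
Proof. by rewrite visitsU negb_or => /andP. Qed.

Let endsT h : ends h \in T -> {ends h \in Cause} + {ends h \in Eff}.
Proof. by rewrite inE; case: (ends h \in Cause) => //= H; [left|right]. Qed.

Let reward_cvgS k :
  \sum_(i < n.+1) exact_expect sigma s i (first_reward s T k) [::] @[n --> \oo] --> lin T k p.
Proof.
rewrite (cvg_shiftS (fun n => \sum_(i < n) exact_expect sigma s i (first_reward s T k) [::])).
exact: sum_first_reward_cvg.
Qed.

(** The first state visited in [T] decides: if it lies in [Eff], it is terminal and [Cause] is never
    reached. *)
Lemma Pr_Cause : Pr (diamond Cause) = lin T (in_ Cause) p.
Proof.
apply: (cvgn_unique _ (@Pr_diamond_limit _ _ _ _ sigma s Cause)
  (@reward_cvgS (in_ Cause))) => n.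
apply: expect_first_reward => // [h vh hT m|h /visitsT[/negPf ->]//].
have [hC|hE] := endsT hT; first by rewrite expect_visited ?hC// visitsE hC orbT.
rewrite expect_terminal ?Eff_terminal// visitsE.
by have [/negPf -> _] := visitedT vh.
Qed.

(** The runs that reach [Eff] but not [Cause] are those that enter [T] in [Eff], since they end
    there. *)
Lemma Pr_Eff : Pr (diamond Eff) = Pr (diamond Eff `&` diamond Cause) + lin T (in_ Eff) p.
Proof.
apply: (cvgn_unique _ (@Pr_diamond_limit _ _ _ _ sigma s Eff)
  (cvgD (@Pr_diamondI_limit _ _ _ _ sigma s Eff Cause) (@reward_cvgS (in_ Eff)))) => n /=.
rewrite -(@expect_first_reward _ _ _ _ _ _ T (in_ Eff)
  (fun h => (visits Eff h && ~~ visits Cause h)%:R))//.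
- rewrite -expectD; apply: expect_ext => h /=.
  by case: (visits Eff _) (visits Cause _) => [] []; rewrite ?addr0 ?add0r.
- move=> h vh hT m; have [vC vE] := visitedT vh; have [hC|hE] := endsT hT.
    have -> : ends h \in Eff = false by apply/negP => /notCause; rewrite hC.
    rewrite -[RHS](expect_const sigma s m 0 h); apply: expect_ext => h'.
    by rewrite (@visits_cat _ _ s Cause) ?andbF// visitsE hC orbT.
  rewrite expect_terminal ?Eff_terminal// !visitsE hE orbT (negPf vC) (negPf (notCause hE)).
  by [].
- by move=> h /visitsT[_ /negPf ->].
Qed.

Let expect_after_Cause n h : ends h \in Cause ->
  expect n (fun h' => (visits Eff h' && visits Cause h')%:R) h =
  expect n (fun h' => (visits Eff h')%:R) h.
Proof.
move=> hC; apply: expect_ext => h'.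
by rewrite (@visits_cat _ _ s Cause) ?andbT// visitsE hC orbT.
Qed.

Lemma Pr_EffCause_le (w : S -> R) : 
  (forall h, ~~ visited T h -> ends h \in Cause ->
     forall n, expect n (fun h' => (visits Eff h')%:R) h <= w (ends h)) ->
  Pr (diamond Eff `&` diamond Cause) <= lin T (fun t => (t \in Cause)%:R * w t) p.
Proof.
move=> Hw; apply: ler_cvg_to (@Pr_diamondI_limit _ _ _ _ sigma s Eff Cause)
  (@reward_cvgS _) _; apply: nearW => n.
apply: expect_first_reward_le => // [h vh hT m|h /visitsT[_ /negPf ->]//].
have [hC|hE] := endsT hT; first by rewrite expect_after_Cause// hC mul1r Hw.
have [/negPf vC _] := visitedT vh.
by rewrite expect_terminal ?Eff_terminal// !visitsE vC (negPf (notCause hE)) andbF mul0r.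
Qed.

Lemma Pr_EffCause_ge (w : S -> R) :
  (forall h, ~~ visited T h -> ends h \in Cause ->
     w (ends h) <= limn (fun n => expect n (fun h' => (visits Eff h')%:R) h)) ->
  lin T (fun t => (t \in Cause)%:R * w t) p <= Pr (diamond Eff `&` diamond Cause).
Proof.
move=> Hw; pose G h : R := (visits Eff h && visits Cause h)%:R.
have Gcvg h : cvgn (fun n => expect n G h).
  apply: (@expect_bool_cvg (fun h => visits Eff h && visits Cause h)) => h' x.
  by rewrite !visits_rcons => /andP[-> ->].
rewrite -(cvg_lim _ (@Pr_diamondI_limit _ _ _ _ sigma s Eff Cause))//.
have lim := @sum_first_reward_cvg _ _ _ _ sigma s T (fun t => (t \in Cause)%:R * w t) p p_lim.
apply: (cvgr_to_le lim).
apply: nearW => n; apply: (@expect_first_reward_ge _ _ _ _ _ _ T _ G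
  (fun h => limn (fun n => expect n G h))) => // h vh hT.
have [hC|hE] := endsT hT.
  rewrite hC mul1r; apply: le_trans (Hw _ vh hC) _.
  rewrite [leLHS](_ : _ = limn (fun n => expect n G h))//.
  by congr (limn _); apply: funext => m; rewrite /G expect_after_Cause.
rewrite (negPf (notCause hE)) mul0r; apply: limr_ge => //; apply: nearW => m.
by have /andP[] := expect_bool m (fun h => visits Eff h && visits Cause h) h.
Qed.

Let Pr01 E : measurable E -> 0 <= Pr E <= 1.
Proof. exact: Pr_itv. Qed.

Let refutes : Prop := 0 < Pr (diamond Cause) /\
  cond_Pr sigma s (diamond Eff) (diamond Cause) <= Pr (diamond Eff).

Let f (w : S -> R) t := (t \in Cause)%:R * w t.
Let f_Eff (w : S -> R) t := f w t + (t \in Eff)%:R.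

Let lin_f_Eff w : lin T (f_Eff w) p = lin T (f w) p + lin T (in_ Eff) p.
Proof. by rewrite /lin -big_split; apply: eq_bigr => t _ /=; rewrite mulrDl. Qed.

(** Let [EC] be the probability of reaching both sets, and [C] and [E] those of entering [T] in
    [Cause] and in [Eff]. Refutation reads [EC * (1 - C) <= C * E]; as [C <= 1], it survives when
    [EC] is replaced by a lower bound. *)
Lemma refutes_refuting (w : S -> R) :
  (forall h, ~~ visited T h -> ends h \in Cause ->
     w (ends h) <= limn (fun n => expect n (fun h' => (visits Eff h')%:R) h)) ->
  refutes -> refuting T (f w) (in_ Cause) (f_Eff w) p.
Proof.
move=> /Pr_EffCause_ge; rewrite -/(f w) => ge_w [C0].
rewrite /cond_Pr ler_pdivrMr// Pr_Eff => Q.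
have /andP[_ C1] := Pr01 (@measurable_diamond _ A s Cause).
rewrite /refuting lin_f_Eff -!Pr_Cause; split => //.
set EC := Pr (_ `&` _) in Q ge_w; nra.
Qed.

(** The same monotonicity, with [EC] below the value used in [refuting]. *)
Lemma refuting_refutes (w : S -> R) :
  (forall h, ~~ visited T h -> ends h \in Cause ->
     forall n, expect n (fun h' => (visits Eff h')%:R) h <= w (ends h)) ->
  refuting T (f w) (in_ Cause) (f_Eff w) p -> refutes.
Proof.
move=> /Pr_EffCause_le; rewrite -/(f w) => le_w.
rewrite /refuting lin_f_Eff -!Pr_Cause => -[Q C0]; split => //.
rewrite /cond_Pr ler_pdivrMr// Pr_Eff.
have /andP[_ C1] := Pr01 (@measurable_diamond _ A s Cause).
set EC := Pr (_ `&` _) in le_w *; nra.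
Qed.

End causes.

End fixed_scheduler.

(** * Residual schedulers and minimising policies *)

Section residual.
Variables (sigma : scheduler M) (s : S) (h0 : hist).

(** [sigma] continued after [h0]. Schedulers take the initial state as an argument; for other
    initial states the choice falls back on [sigma] itself. *)
Definition residual_choice (u : S) (h : hist) : A -> R :=
  if u == last_state s h0 then sigma s (h0 ++ h) else sigma u h.

Lemma last_state_cat (h : hist) : last_state s (h0 ++ h) = last_state (last_state s h0) h.
Proof. by rewrite /last_state map_cat last_cat. Qed.

Fact residual_ge0 u h a : 0 <= residual_choice u h a.
Proof. by rewrite /residual_choice; case: ifP => _; exact: choice_ge0. Qed.

Fact residual_enabled u h a : ~~ enabled M (last_state u h) a -> residual_choice u h a = 0.
Proof.
rewrite /residual_choice; case: eqP => [->|_]; last exact: choice_enabled.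
by rewrite -last_state_cat; exact: choice_enabled.
Qed.

Fact residual_sum u h : ~~ terminal M (last_state u h) -> \sum_a residual_choice u h a = 1.
Proof.
rewrite /residual_choice; case: eqP => [->|_]; last exact: choice_sum.
by rewrite -last_state_cat; exact: choice_sum.
Qed.

Definition residual : scheduler M := Scheduler residual_ge0 residual_enabled residual_sum.

Lemma expect_residual n (G : hist -> R) h :
  expect sigma s n G (h0 ++ h) =
  expect residual (last_state s h0) n (fun h' => G (h0 ++ h')) h.
Proof.
elim: n h => //= n IH h; rewrite last_state_cat IH; congr (_ + _).
apply: eq_bigr => a _; apply: eq_bigr => t _.
by rewrite rcons_cat IH last_state_cat /= /residual_choice eqxx.
Qed.

(** The residual scheduler takes part in the infimum, and its runs reach [Eff] exactly when the
    continuations of [h0] do. *)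
Lemma Pr_min_le_expect (Eff : {set S}) : ~~ visited s Eff h0 ->
  Pr_min M (last_state s h0) Eff <=
  limn (fun n => expect sigma s n (fun h => (visits s Eff h)%:R) h0).
Proof.
move=> vh0; set u := last_state s h0.
have -> : (fun n => expect sigma s n (fun h => (visits s Eff h)%:R) h0) =
    (fun n => expect residual u n (fun h => (visits u Eff h)%:R) [::]).
  apply: funext => n; rewrite -{1}(cats0 h0) expect_residual; apply: expect_ext => h /=.
  rewrite /visits map_cat -cat_cons has_cat lastI has_rcons.
  by rewrite -[has _ (belast _ _)]/(visited s Eff h0) (negPf vh0) orbF.
rewrite (cvg_lim _ (@Pr_diamond_limit _ _ _ _ residual u Eff))//.
apply: ge_inf; last by exists residual.
exists 0 => _ [tau _ <-].
by have /andP[] := Pr_itv tau u (@measurable_diamond _ A u Eff).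
Qed.

End residual.

Definition scheduler_of (dec : S -> hist -> S -> A -> R)
    (Hdec : forall u h, policy M (dec u h)) : scheduler M :=
  @Scheduler R S A M (fun u h => dec u h (last_state u h))
    (fun u h a => let: And3 d0 _ _ := Hdec u h in d0 _ a)
    (fun u h a => let: And3 _ d1 _ := Hdec u h in d1 _ a)
    (fun u h => let: And3 _ _ d2 := Hdec u h in d2 _).

(** One half of the optimality equation, for a greedy policy: every scheduler makes a step and then
    reaches [Eff] with at least the minimal probability of the successor. By [expect_visits_le] the
    policy is therefore optimal. *)
Lemma Pr_min_policy (Eff : {set S}) : exists2 rho, policy M rho &
  forall u, ~~ terminal M u -> u \notin Eff ->
    \sum_a rho u a * \sum_t trans M u a t * (if t \in Eff then 1 else Pr_min M t Eff) <=
    Pr_min M u Eff.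
Proof.
pose w t : R := if t \in Eff then 1 else Pr_min M t Eff.
pose value u a := \sum_t trans M u a t * w t.
pose best u a := enabled M u a && [forall b, enabled M u b ==> (value u a <= value u b)].
have best_ex u : ~~ terminal M u -> exists a, best u a.
  move=> /nonterminal_enabled[a0 a0u].
  case: (@arg_minP _ _ _ a0 (enabled M u) (value u) a0u) => a au amin.
  exists a; rewrite /best au; apply/forallP => b; apply/implyP; exact: amin.
exists (point_choice R best).
  split=> [u a|u a ua|u /best_ex]; first exact: ler0n.
    by apply/eqP; apply: contraNT ua => /point_choice_neq0 /andP[].
  exact: point_choice_sum.
move=> u ut uE; have [a0 /andP[a0u /forallP a0min]] := best_ex u ut.
have pcE : \sum_a point_choice R best u a * value u a = value u a0.
  have -> : value u a0 = \sum_a point_choice R best u a * value u a0.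
    by rewrite -mulr_suml point_choice_sum ?mul1r//; exact: best_ex.
  apply: eq_bigr => a _; have [->|] := eqVneq (point_choice R best u a) 0.
    by rewrite !mul0r.
  move=> /point_choice_neq0/andP[au /forallP amin]; congr (_ * _); apply/eqP.
  by rewrite eq_le (implyP (amin a0) a0u) (implyP (a0min a) au).
rewrite pcE; have [d dpol] := policy_exists M.
apply: lb_le_inf.
  by exists (Pr (scheduler_of (fun _ _ => dpol)) u (diamond u Eff)); eexists.
move=> _ [tau _ <-].
have vu : ~~ visited u Eff ([::] : hist) by [].
have lim := @Pr_diamond_limit _ _ _ _ tau u Eff.
have lim1 : expect tau u n.+1 (fun h => (visits u Eff h)%:R) [::] @[n --> \oo] -->
    Pr tau u (diamond u Eff).
  by rewrite (cvg_shiftS (fun n => expect tau u n (fun h => (visits u Eff h)%:R) [::])).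
pose l h := limn (fun n => expect tau u n (fun h => (visits u Eff h)%:R) h).
(* The reachability probability of [tau] is the one-step expectation of those after the step. *)
have lim2 : expect tau u n.+1 (fun h => (visits u Eff h)%:R) [::] @[n --> \oo] -->
    step tau u l [::].
  have : step tau u (expect tau u n (fun h => (visits u Eff h)%:R)) [::] @[n --> \oo] -->
      step tau u l [::].
    apply: cvg_sumr => a _; apply: cvg_sumr => t _; apply: cvgM; first exact: cvg_cst.
    by apply: expect_bool_cvg => h x; rewrite visits_rcons => ->.
  by apply: eq_cvgn => n; rewrite expect_nonterminal.
rewrite -(cvg_unique _ lim2 lim1)//.
apply: (@le_trans _ _ (\sum_a tau u [::] a * value u a0)).
  by rewrite -mulr_suml choice_sum// mul1r.
apply: (@le_trans _ _ (\sum_a tau u [::] a * value u a)).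
  apply: ler_sum => a _; have [ua|ua] := boolP (enabled M u a).
    by rewrite ler_wpM2l ?choice_ge0// (implyP (a0min a)).
  by rewrite (choice_enabled tau (s := u) (h := [::]))// !mul0r.
apply: ler_sum => a _; rewrite mulr_sumr; apply: ler_sum => t _.
rewrite mulrA ler_wpM2l//; first by rewrite mulr_ge0 ?choice_ge0 ?trans_ge0.
rewrite /w; case: ifPn => tE; rewrite /l.
  apply: limr_ge; first by apply: expect_bool_cvg => h x; rewrite visits_rcons => ->.
  by apply: nearW => n; rewrite expect_visited// visits_rcons /= tE orbT.
have := @Pr_min_le_expect tau u [:: (a, t)] Eff.
by apply; rewrite /visited /= (negPf uE).
Qed.

End reachability.

(** * The two refuting schedulers *)

Lemma first_mass_memoryless (R : realType) (S A : finType) (M : mdp R S A)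
    (T : {set S}) (sigma : scheduler M) (d : S -> A -> R) :
  (forall h a, ~~ visits (init M) T h -> sigma (init M) h a = d (last_state (init M) h) a) ->
  forall n t, first_mass sigma (init M) T n t = mass M T d n t.
Proof.
move=> sd; elim=> [|n IH] t; first by rewrite first_mass0.
rewrite first_massS; apply: eq_bigr => u _; apply: eq_bigr => a _.
by rewrite (first_flow_memoryless _ sd) IH.
Qed.

(** * The memoryless scheduler for the MDP with the fresh action *)

Section wmin_theory.
Variables (R : realType) (S A : finType) (M : mdp R S A).
Variables (Eff Cause : {set S}) (eff : S) (noeff : option S).
Hypotheses (Eff_terminal : forall e : S, e \in Eff -> terminal M e)
  (Cause_Eff : Cause \subset ~: Eff) (eff_Eff : eff \in Eff)
  (noeff_terminal : forall t : S, noeff = Some t ->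
     [/\ terminal M t, t \notin Eff & t \notin Cause]).
Let N := wmin M Eff Cause eff noeff.
Let emb : S -> wmin_state noeff := @wmin_embed S noeff.
Local Notation T := (Cause :|: Eff).
Local Notation wmin_T := (emb @: Cause :|: emb @: Eff).

Let emb_inj : injective emb.
Proof. by move=> u v /(congr1 val) []. Qed.

Let mem_emb (U : {set S}) u : (emb u \in emb @: U) = (u \in U).
Proof. exact: mem_imset. Qed.

Let wmin_stateP (v : wmin_state noeff) : (exists s, v = emb s) \/ val v = None.
Proof. by case: v => [[s|] pv]; [left; exists s; exact: val_inj|right]. Qed.

Let sum_option (F : option A -> R) : \sum_b F b = F None + \sum_a F (Some a).
Proof.
rewrite (bigD1 None) //=; congr (_ + _).
rewrite (reindex_omap Some id) /=; last by case.
by apply: eq_bigl => a; rewrite eqxx.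
Qed.

Let sum_wmin (F : wmin_state noeff -> R) : (forall v, val v = None -> F v = 0) ->
  \sum_v F v = \sum_s F (emb s).
Proof.
move=> F0; rewrite (bigID (fun v : wmin_state noeff => isSome (val v))) /= addrC big1.
  rewrite add0r (reindex_omap emb (fun v : wmin_state noeff => val v)) /=.
    by apply: eq_bigl => t; rewrite eqxx.
  by move=> [[t|] //= pt] _; congr Some; apply: val_inj.
by move=> v; case vE: (val v) => // _; exact: F0.
Qed.

Let sum_pred1 (v : wmin_state noeff) (F : wmin_state noeff -> R) :
  \sum_u (u == v)%:R * F u = F v.
Proof. by rewrite (bigD1 v)//= eqxx mul1r big1 ?addr0// => u /negPf ->; rewrite mul0r. Qed.

Let enabled_emb s a : s \notin Cause -> enabled N (emb s) (Some a) = enabled M s a.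
Proof.
move=> /negPf sC; rewrite /enabled /= /wmin_trans /= sC sum_wmin//.
by move=> v ->.
Qed.

Let disabled_none (v : wmin_state noeff) b : val v = None -> ~~ enabled N v b.
Proof.
by move=> vN; rewrite /enabled /= big1 ?(eq_sym 0) ?oner_eq0// => u _; rewrite /wmin_trans vN.
Qed.

Let disabled_gamma s : s \notin Cause -> ~~ enabled N (emb s) None.
Proof.
move=> /negPf sC; rewrite /enabled /= big1 ?(eq_sym 0) ?oner_eq0// => u _.
by rewrite /wmin_trans /= sC.
Qed.

Let terminal_emb s : s \notin Cause -> terminal N (emb s) = terminal M s.
Proof.
move=> sC; apply/forallP/forallP => H a; first by rewrite -enabled_emb.
by case: a => [a|]; [rewrite enabled_emb|exact: disabled_gamma].
Qed.

Let terminal_noeff : terminal N (wmin_noeff noeff).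
Proof.
have [[t nt]|nN] := wmin_stateP (wmin_noeff noeff); last first.
  by apply/forallP => b; exact: disabled_none.
have [tt _ tC] := noeff_terminal (congr1 val nt).
by rewrite nt terminal_emb.
Qed.

Let notCause e : e \in Eff -> e \notin Cause.
Proof. by move=> eE; apply/negP => /(fintype.subsetP Cause_Eff); rewrite inE eE. Qed.

Let noeff_notin (U : {set S}) : (forall t, noeff = Some t -> t \notin U) ->
  wmin_noeff noeff \notin emb @: U.
Proof.
move=> H; apply/imsetP => -[u uU /(congr1 val)] /= E.
by have := H u E; rewrite uU.
Qed.

Section policy.
Variables (d : S -> A -> R) (d_policy : policy M d).

Definition wmin_choice (v : wmin_state noeff) (b : option A) : R :=
  match val v, b with
  | Some s, Some a => if s \in Cause then 0 else d s a
  | Some s, None => (s \in Cause)%:R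
  | None, _ => 0
  end.

Lemma wmin_choice_policy : policy N wmin_choice.
Proof.
have [d0 dis dsum] := d_policy; split=> [v b|v b vb|v vt].
- rewrite /wmin_choice; by case: (val v) b => [s|] [a|] //=; case: ifP.
- have [[s vs]|vN] := wmin_stateP v; last by rewrite /wmin_choice vN.
  rewrite vs /wmin_choice /= in vb *; have [sC|sC] := boolP (s \in Cause).
    case: b vb => // /negP[]; apply/eqP; rewrite /= /wmin_trans /= sC.
    rewrite big_split /= -!mulr_sumr.
    rewrite -(eq_bigr _ (fun u _ => mulr1 _)) sum_pred1.
    by rewrite -(eq_bigr _ (fun u _ => mulr1 _)) sum_pred1; ring.
  by case: b vb => [a|//]; rewrite enabled_emb// => /dis.
- have [[s vs]|vN] := wmin_stateP v; last first.
    by move: vt; rewrite negb_forall => /existsP[b]; rewrite disabled_none.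
  rewrite vs /wmin_choice /= sum_option in vt *; have [sC|sC] := boolP (s \in Cause).
    by rewrite big1 ?addr0.
  by rewrite add0r dsum// -terminal_emb.
Qed.

(** States of [T] pass no mass on, so the changed actions in [Cause] have no influence before the
    first visit to [T]. *)
Lemma mass_wmin n t : mass N wmin_T wmin_choice n (emb t) = mass M T d n t.
Proof.
elim: n t => [|n IH] t /=; first by rewrite /source (inj_eq emb_inj).
rewrite /inflow sum_wmin => [|v vN]; last first.
  by rewrite big1// => b _; rewrite /wmin_choice vN mulr0 mul0r.
apply: eq_bigr => s _; rewrite sum_option IH !inE !mem_emb.
have [sC|sC] := boolP (s \in Cause).
  by rewrite /= !mul0r add0r !big1// => a _; rewrite !mul0r.
rewrite /wmin_choice /= (negPf sC) mulr0 mul0r add0r; apply: eq_bigr => a _.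
by rewrite /wmin_trans /= (negPf sC).
Qed.

(** A superharmonic bound on reaching [Eff], exact in [Cause] and at [noeff]. It is applied from
    states of [Cause], where the trivial value 1 elsewhere does no harm. *)
Let w (v : wmin_state noeff) : R :=
  if v \in emb @: Cause then oapp (fun s => Pr_min M s Eff) 0 (val v)
  else (v != wmin_noeff noeff)%:R.

Let w01 v : 0 <= w v <= 1.
Proof.
rewrite /w; case: ifP => _; last by rewrite ler0n lern1 leq_b1.
by case: (val v) => [s|] /=; [exact: Pr_min_itv|rewrite lexx ler01].
Qed.

Let w_Cause s : s \in Cause -> w (emb s) = Pr_min M s Eff.
Proof. by move=> sC; rewrite /w mem_emb sC. Qed.

Let w_Eff s : s \in Eff -> w (emb s) = 1.
Proof.
move=> sE; rewrite /w mem_emb (negPf (notCause sE)).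
suff -> : emb s != wmin_noeff noeff by [].
apply: contraTneq sE => /(congr1 val) /= sn.
by have [] := noeff_terminal (esym sn).
Qed.

Let w_noeff : w (wmin_noeff noeff) = 0.
Proof.
by rewrite /w (negPf (noeff_notin _)) ?eqxx// => t /noeff_terminal[].
Qed.

Let w_super v : ~~ terminal N v ->
  \sum_b wmin_choice v b * \sum_u trans N v b u * w u <= w v.
Proof.
move=> vt; have [[s vs]|vN] := wmin_stateP v; last first.
  by move: vt; rewrite negb_forall => /existsP[b]; rewrite disabled_none.
have [sC|sC] := boolP (s \in Cause).
  rewrite vs w_Cause// sum_option [X in _ + X]big1 ?addr0 => [|a _]; last first.
    by rewrite /wmin_choice /= sC mul0r.
  rewrite /wmin_choice /= sC mul1r /wmin_trans /= sC.
  under eq_bigr do rewrite mulrDl -!mulrA.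
  rewrite big_split /= -!mulr_sumr !sum_pred1 w_noeff mulr0 addr0.
  by rewrite (w_Eff eff_Eff) mulr1.
have -> : w v = 1.
  rewrite /w vs mem_emb (negPf sC); suff -> : emb s != wmin_noeff noeff by [].
  by apply: contraNneq vt; rewrite vs => ->; exact: terminal_noeff.
have [c0 _ _] := wmin_choice_policy.
apply: le_trans (policy_sum_le1 v wmin_choice_policy).
apply: ler_sum => b _; rewrite ler_piMr//.
apply: (@le_trans _ _ (\sum_u trans N v b u)).
  by apply: ler_sum => u _; rewrite ler_piMr ?trans_ge0//; case/andP: (w01 u).
by case: (trans_sum N v b) => ->; rewrite ?ler01.
Qed.

(** The transferred policy enters [T] with the same probabilities [q], and in [Cause] the fresh
    action realises the minimal probability of [Eff]. *)
Lemma refuting_wmin (q : S -> R) :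
  (forall t, t \in T -> (\sum_(i < n) mass M T d i t) @[n --> \oo] --> q t) ->
  refuting T (fun t => (t \in Cause)%:R * Pr_min M t Eff) (fun t => (t \in Cause)%:R)
    (fun t => (t \in Cause)%:R * Pr_min M t Eff + (t \in Eff)%:R) q ->
  exists sigma : scheduler N, memoryless sigma /\
    refutes_GPR (emb @: Eff) (emb @: Cause) sigma.
Proof.
move=> qlim qref; pose sigma := scheduler_of (fun _ _ => wmin_choice_policy).
exists sigma; split; first by exists wmin_choice.
pose q' (v : wmin_state noeff) : R := oapp q 0 (val v).
have lin_emb k k' : (forall t, k' (emb t) = k t) -> lin wmin_T k' q' = lin T k q.
  move=> kk; rewrite /lin -imsetU big_imset /=; last by move=> u v _ _; exact: emb_inj.
  by apply: eq_bigr => t _; rewrite kk.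
apply: (@refuting_refutes _ _ _ N sigma (init N) (emb @: Eff) (emb @: Cause) _ _ q' _ w).
- by move=> _ /imsetP[e eE ->]; rewrite terminal_emb ?notCause ?Eff_terminal.
- apply/fintype.subsetP => _ /imsetP[c cC ->]; rewrite inE mem_emb.
  by move/fintype.subsetP : Cause_Eff => /(_ c cC); rewrite inE.
- move=> v vT; have /imsetP[t tT vt] : v \in emb @: T by rewrite imsetU.
  rewrite vt; apply: eq_cvgn (qlim t tT) => n.
  apply: eq_bigr => i _; rewrite -mass_wmin.
  exact: (@first_mass_memoryless _ _ _ N wmin_T sigma wmin_choice).
- move=> h vh hC n; apply: (@expect_visits_le _ _ _ N sigma _ _ _ xpredT) => //.
  + by move=> u; case/andP: (w01 u).
  + by move=> _ /imsetP[e eE ->]; rewrite w_Eff.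
  + by move=> h' _ ht _; exact: w_super.
  + by move: vh; rewrite visitedU negb_or => /andP[].
- have [Q C] := qref; rewrite /refuting.
  rewrite (lin_emb (fun t => (t \in Cause)%:R * Pr_min M t Eff)) => [|t]; last first.
    by rewrite mem_emb; case: (boolP (t \in Cause)) => tC; rewrite ?mul0r// w_Cause.
  rewrite (lin_emb (fun t => (t \in Cause)%:R)) => [|t]; last by rewrite mem_emb.
  rewrite (lin_emb (fun t => (t \in Cause)%:R * Pr_min M t Eff + (t \in Eff)%:R)) => [//|t].
  by rewrite !mem_emb; case: (boolP (t \in Cause)) => tC; rewrite ?mul0r// w_Cause.
Qed.

End policy.

End wmin_theory.

(** * The scheduler with two memory cells *)

Section two_memory.
Variables (R : realType) (S A : finType) (M : mdp R S A) (Eff Cause : {set S}).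
Hypotheses (Eff_terminal : forall e : S, e \in Eff -> terminal M e)
  (Cause_Eff : Cause \subset ~: Eff).
Variables (d : S -> A -> R) (d_policy : policy M d).
Local Notation T := (Cause :|: Eff).

(** The cell [ord_max] records for ever that [Cause] has been visited. *)
Let update (m : 'I_2) (u : S) : 'I_2 :=
  if (m == ord_max) || (u \in Cause) then ord_max else ord0.

Let foldl_update (m : 'I_2) l :
  (foldl update m l == ord_max) = (m == ord_max) || has (mem Cause) l.
Proof.
elim: l m => [|u l IH] m /=; first by rewrite orbF.
by rewrite IH orbA; congr (_ || _); rewrite /update; case: ifP.
Qed.

(** Follow [d] until [Cause] is visited, then the minimising policy [rho]; the memory tells the two
    phases apart. *)
Lemma refuting_two_memory (q : S -> R) :
  (forall t, t \in T -> (\sum_(i < n) mass M T d i t) @[n --> \oo] --> q t) ->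
  refuting T (fun t => (t \in Cause)%:R * Pr_min M t Eff) (fun t => (t \in Cause)%:R)
    (fun t => (t \in Cause)%:R * Pr_min M t Eff + (t \in Eff)%:R) q ->
  exists sigma : scheduler M, finite_memory 2 sigma /\ refutes_GPR Eff Cause sigma.
Proof.
move=> qlim qref; have [rho rho_policy rho_min] := Pr_min_policy M Eff.
pose dec (u : S) (h : seq (A * S)) := if visits u Cause h then rho else d.
have dec_policy u h : policy M (dec u h) by rewrite /dec; case: ifP.
pose sigma := scheduler_of dec_policy; exists sigma; split.
  exists ord0, update, (fun m => if m == ord_max then rho else d) => s h a.
  by rewrite foldl_update.
apply: (@refuting_refutes _ _ _ M sigma (init M) Eff Cause _ _ q _
  (fun t => Pr_min M t Eff)) => // [t tT|h vh hC n].
  apply: eq_cvgn (qlim t tT) => n; apply: eq_bigr => i _.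
  apply: first_mass_memoryless => h a; rewrite visitsU negb_or => /andP[vC _] /=.
  by rewrite /dec (negPf vC).
have hE : last_state (init M) h \notin Eff.
  by move/fintype.subsetP : Cause_Eff => /(_ _ hC); rewrite inE.
pose w t : R := if t \in Eff then 1 else Pr_min M t Eff.
have -> : Pr_min M (last_state (init M) h) Eff = w (last_state (init M) h).
  by rewrite /w (negPf hE).
apply: (@expect_visits_le _ _ _ M sigma (init M) Eff w (visits (init M) Cause)).
- by move=> u; rewrite /w; case: ifP => // _; have /andP[] := Pr_min_itv M u Eff.
- by move=> u uE; rewrite /w uE.
- by move=> h' x; rewrite visits_rcons => ->.
- move=> h' vh' th' hE'; rewrite {2}/w (negPf hE') /= /dec vh'; exact: rho_min.
- by rewrite visitsE hC orbT.
- by move: vh; rewrite visitedU negb_or => /andP[].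
Qed.

End two_memory.

Theorem theorem4p12 (R : realType) (S A : finType) (M : mdp R S A)
    (Eff Cause : {set S}) (eff : S) (noeff : option S)
    (reachable_all : forall s : S, reachable M s)
    (init_Eff : init M \notin Eff)
    (Eff_neq0 : Eff != finset.set0)
    (Eff_terminal : forall e : S, e \in Eff -> terminal M e)
    (Cause_Eff : Cause \subset ~: Eff)
    (Cause_neq0 : Cause != finset.set0)
    (Cause_first : each_cause_reached_first M Cause)
    (eff_Eff : eff \in Eff)
    (noeff_terminal : forall t : S, noeff = Some t ->
       [/\ terminal M t, t \notin Eff & t \notin Cause]) :
  ~ GPR_cause M Eff Cause ->
  (exists sigma : scheduler (wmin M Eff Cause eff noeff),
     memoryless sigma /\
     refutes_GPR (@wmin_embed S noeff @: Eff) (@wmin_embed S noeff @: Cause) sigma) /\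
  (exists sigma : scheduler M,
     finite_memory 2 sigma /\ refutes_GPR Eff Cause sigma).
Proof.
move=> notGPR.
(* The hypotheses supply the other clauses of [GPR_cause], so it is the last one that fails. *)
have [sigma ref] : exists sigma : scheduler M, refutes_GPR Eff Cause sigma.
  apply: contrapT => noref; apply: notGPR; split => // sigma C0.
  rewrite /GPR_condition ltNge; apply/negP => le; apply: noref.
  by exists sigma.
have [p plim] := first_mass_cvg sigma (init M) (Cause :|: Eff).
have pref : refuting (Cause :|: Eff) (fun t => (t \in Cause)%:R * Pr_min M t Eff)
    (fun t => (t \in Cause)%:R)
    (fun t => (t \in Cause)%:R * Pr_min M t Eff + (t \in Eff)%:R) p.
  apply: refutes_refuting ref => // h; rewrite visitedU negb_or => /andP[_ vE] _.
  exact: Pr_min_le_expect.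
have w01 u := Pr_min_itv M u Eff.
(* The first-visit masses of [sigma] are traded for those of one memoryless policy [d], from which
   both schedulers are built. *)
have [|||d [q [dpol qlim qref]]] := memoryless_refutation _ _ _
  (@first_flow_ge0 _ _ _ _ sigma (init M) (Cause :|: Eff))
  (@first_flow_supp _ _ _ _ sigma (init M) (Cause :|: Eff))
  (@first_mass0 _ _ _ _ sigma (init M) (Cause :|: Eff))
  (@first_massS _ _ _ _ sigma (init M) (Cause :|: Eff))
  (@first_flow_out _ _ _ _ sigma (init M) (Cause :|: Eff)) plim pref.
- by move=> u; rewrite mulr_ge0//; case/andP: (w01 u).
- by move=> u; rewrite ler_piMr//; case/andP: (w01 u).
- by move=> u; rewrite addr_ge0 ?ler0n// mulr_ge0//; case/andP: (w01 u).
split; first exact: refuting_wmin qlim qref.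
exact: refuting_two_memory qlim qref.
Qed.
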